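(* Let $\mathbb{V}$ be a real vector space of finite positive dimension, let $\phi:\mathbb{V}\to\mathbb{Z}$ be a PL-constructible function, let $p\in\mathbb{N}$ and let $\kappa:\mathbb{R}\to\mathbb{C}$ be of class $C^p$. There exists a finite family $\{\Gamma_1,\dots,\Gamma_m\}$ of open convex polyhedral cones of $\mathbb{V}^*$ such that $\mathbb{V}^*=\bigcup_{i=1}^m\overline{\Gamma_i}$ and: (i) If $\mathrm{supp}(\phi)$ is compact, then the restriction $\mathrm{T}_\kappa[\phi]_{|\Gamma_i}$ is $C^{p+1}$ for all $i=1,\dots,m$. (ii) If $\mathrm{supp}(\phi)\subseteq K+C$ with $K$ convex compact and $C\ne\{0\}$ a non-empty closed convex cone, then (a) the restriction $\mathrm{T}_\kappa[\phi]_{|\Gamma_i\cap\mathrm{Int}(C^\circ)}$ is $C^{p+1}$ for all $i=1,\dots,m$ when $\kappa\in L^1(\mathbb{R}_{\ge0})$, (b) the restriction $\mathrm{T}_\kappa[\phi]_{|\Gamma_i\cap\mathrm{Int}(C^{a\circ})}$ is $C^{p+1}$ for all $i=1,\dots,m$ when $\kappa\in L^1(\mathbb{R}_{\le0})$.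
   Context: A cone is a subset $C$ of a vector space with $\mathbb{R}_{>0}\cdot C\subseteq C$; $C^a=-C$; the polar of a cone $C\subseteq\mathbb{V}$ is $C^\circ=\{\xi\in\mathbb{V}^*:\xi(C)\subseteq\mathbb{R}_{\ge0}\}$ and $C^{a\circ}=(C^a)^\circ$. A convex polyhedron is an intersection of finitely many open or closed affine half-spaces; a convex polyhedral cone is a convex polyhedron that is also a cone. A function $\phi:\mathbb{V}\to\mathbb{Z}$ is PL-constructible if there is a finite partition $\mathbb{V}=\bigsqcup_{a\in A}P_a$ into convex polyhedra with $\phi$ constant on each $P_a$. **Euler calculus.** For a compactly supported function $\psi:X\to\mathbb{Z}$ on a real analytic manifold, constructible (i.e. with subanalytic level sets forming a locally finite family), write $\psi=\sum_i m_i\mathbf{1}_{K_i}$ (finite sum) with $m_i\in\mathbb{Z}$ and $K_i$ compact contractible subanalytic, and set $\int_X\psi\,\mathrm{d}\chi=\sum_im_i$ (independent of the decomposition). For $\xi\in\mathbb{V}^*$ proper on $\mathrm{supp}(\phi)$, $\xi_*\phi(t)=\int_{\mathbb{V}}\mathbf{1}_{\xi^{-1}(t)}\cdot\phi\,\mathrm{d}\chi$, $t\in\mathbb{R}$. **Hybrid transform.** $\mathrm{T}_\kappa[\phi](\xi)=\int_{\mathbb{R}}\kappa(t)\,\xi_*\phi(t)\,\mathrm{d}t$, defined for those $\xi\in\mathbb{V}^*$ such that $\xi$ is proper on $\mathrm{supp}(\phi)$ and $\kappa\cdot\xi_*\phi\in L^1(\mathbb{R})$ (for compactly supported $\phi$: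 for all $\xi\in\mathbb{V}^*$). *)

(* Defs.v *)
From HB Require Import structures.
From mathcomp Require Import all_boot all_order all_algebra.
From mathcomp Require Import complex.
From mathcomp Require Import all_classical all_reals all_analysis.

Set Implicit Arguments.
Unset Strict Implicit.
Unset Printing Implicit Defensive.

Import Order.TTheory GRing.Theory Num.Theory.
Import numFieldNormedType.Exports passmx.

Local Open Scope classical_set_scope.
Local Open Scope ring_scope.

(* MathComp's finite-dimensional spaces carry no topology.  [normedvect W] is
   [W] with the sup norm of its coordinates; since all norms on a
   finite-dimensional real vector space are equivalent, the resulting topology,
   compactness and differentiability are the canonical ones. *)
Definition normedvect (R : realType) (W : vectType R) : Type := W.

Section NormedVect.
Variables (R : realType) (W : vectType R).

HB.instance Definition _ := GRing.Lmodule.on (normedvect W).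

Definition coords (x : W) : 'rV[R]_(\dim {:W}) := rVof (vbasis fullv) x.

Definition vect_norm (x : normedvect W) : R := `|coords x|.

Lemma vect_normD x y : vect_norm (x + y) <= vect_norm x + vect_norm y.
Proof. by rewrite /vect_norm /coords linearD ler_normD. Qed.

Lemma vect_normZ (a : R) x : vect_norm (a *: x) = `|a| * vect_norm x.
Proof. by rewrite /vect_norm /coords linearZ normrZ. Qed.

Lemma vect_norm_eq0 x : vect_norm x = 0 -> x = 0.
Proof.
move=> /normr0_eq0 x0; rewrite -[RHS](rVofK (vbasisP (fullv : {vspace W})) 0).
by rewrite linear0 -[LHS](rVofK (vbasisP (fullv : {vspace W}))) [rVof _ _]x0.
Qed.

HB.instance Definition _ := Lmodule_isNormed.Build R (normedvect W)
  vect_normD vect_normZ vect_norm_eq0.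

End NormedVect.

Definition dual (R : realType) (W : vectType R) : vectType R := 'Hom(W, R^o).

Section Cones.
Variables (R : realType) (W : vectType R).
Implicit Types C P : set (normedvect W).

Definition cone C := forall (a : R) x, 0 < a -> C x -> C (a *: x).

Definition antipode C : set (normedvect W) := [set - x | x in C].

Definition polar C : set (normedvect (dual W)) :=
  [set xi : dual W | forall x, C x -> (0 : R) <= xi x].

Definition half_space P := exists (l : dual W) (c : R), l != 0 /\
  (P = [set x : W | (c : R) <= l x] \/ P = [set x : W | (c : R) < l x]).

Definition convex_polyhedron P :=
  exists (n : nat) (H : 'I_n -> set (normedvect W)),
    (forall i, half_space (H i)) /\ P = \bigcap_i H i.

Definition PL_constructible (phi : normedvect W -> int) :=
  exists (n : nat) (P : 'I_n -> set (normedvect W)),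
    [/\ partition setT P setT,
        forall i, convex_polyhedron (P i)
      & forall i x y, P i x -> P i y -> phi x = phi y].

Definition supp (phi : normedvect W -> int) : set (normedvect W) :=
  closure [set x | phi x != 0].

End Cones.

Section Subanalytic.
Variables (R : realType).

Definition monomial (W : vectType R) (h : W)
    (alpha : {ffun 'I_(\dim {:W}) -> nat}) : R :=
  \prod_i coords h 0 i ^+ alpha i.

(* A power series at a converging absolutely to f on a ball; its sum is
   computed along the boxes {alpha | forall i, alpha i < N}. *)
Definition real_analytic_at (W : vectType R) (f : W -> R) (a : W) :=
  exists (r : R) (c : {ffun 'I_(\dim {:W}) -> nat} -> R), 0 < r /\
  forall h : normedvect W, `|h| < r ->
    summable setT (fun alpha => (c alpha * monomial h alpha)%:E) /\
    (\sum_(alpha : {ffun 'I_(\dim {:W}) -> 'I_N})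
       c [ffun i => val (alpha i)] * monomial h [ffun i => val (alpha i)])
      @[N --> \oo] --> f (a + h).

Definition semianalytic (W : vectType R) (A : set (normedvect W)) :=
  forall a, exists (U : set (normedvect W)) (n p q : nat)
    (f : 'I_n -> 'I_p -> W -> R) (g : 'I_n -> 'I_q -> W -> R),
    [/\ open U, U a,
        forall i j x, U x -> real_analytic_at (f i j) x,
        forall i j x, U x -> real_analytic_at (g i j) x
      & A `&` U = U `&` \bigcup_i
          [set x | (forall j, f i j x = 0) /\ (forall j, 0 < g i j x)]].

(* The usual definition projects a relatively compact semianalytic subset of
   W x N for an analytic manifold N; embedding N analytically as a closed
   submanifold of some R^m, one may take N = R^m. *)
Definition subanalytic (W : vectType R) (A : set (normedvect W)) :=
  forall a, exists (U : set (normedvect W)) (m : nat)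
    (B : set (normedvect (W * 'rV[R]_m)%type)),
    [/\ open U, U a, semianalytic B, compact (closure B)
      & A `&` U = [set x.1 | x in B]].

End Subanalytic.

Definition contractible (R : realType) (T : topologicalType) (K : set T) :=
  exists (x0 : T) (H : T * R -> T),
    [/\ K x0, {within K `*` `[0, 1], continuous H},
        forall x t, K x -> 0 <= t <= 1 -> K (H (x, t)),
        forall x, K x -> H (x, 0) = x
      & forall x, K x -> H (x, 1) = x0].

Section HybridTransform.
Variables (R : realType) (V : vectType R).
Implicit Types (phi : normedvect V -> int) (xi : dual V) (kappa : R -> R[i]).

(* The Euler integral is the functional whose value on a combination of
   indicators of compact contractible subanalytic sets is the sum of the
   coefficients.  That such a functional exists is the independence of the
   decomposition; its values are uniquely determined on combinations of this
   form, i.e. on compactly supported constructible functions. *)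
Definition is_euler_integral (I : (normedvect V -> int) -> int) :=
  forall (n : nat) (m : 'I_n -> int) (K : 'I_n -> set (normedvect V)),
    (forall i, [/\ compact (K i), contractible R (K i) & subanalytic (K i)]) ->
    I (fun x => \sum_(i < n) m i * \1_(K i) x) = \sum_(i < n) m i.

Definition euler_integral : (normedvect V -> int) -> int :=
  xget (fun=> 0) is_euler_integral.

Definition proper_on (S : set (normedvect V)) xi :=
  forall B : set R, compact B -> compact (S `&` [set x : V | B (xi x)]).

Definition pushforward xi phi (t : R) : int :=
  euler_integral (fun x => \1_[set y : V | xi y = t] x * phi x).

Definition cintegrable (D : set R) (f : R -> R[i]) :=
  (@lebesgue_measure R).-integrable D (fun t => (complex.Re (f t))%:E) /\
  (@lebesgue_measure R).-integrable D (fun t => (complex.Im (f t))%:E).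

Definition cintegral (f : R -> R[i]) : R[i] :=
  Complex (\int[@lebesgue_measure R]_t complex.Re (f t))
          (\int[@lebesgue_measure R]_t complex.Im (f t)).

Definition hybrid_domain kappa phi : set (normedvect (dual V)) :=
  [set xi | proper_on (supp phi) xi /\
            cintegrable setT (fun t => kappa t *~ pushforward xi phi t)].

(* Meaningful on [hybrid_domain kappa phi] only. *)
Definition hybrid kappa phi (xi : normedvect (dual V)) : R[i] :=
  cintegral (fun t => kappa t *~ pushforward xi phi t).

End HybridTransform.

Section ClassCk.
Variables (R : realType) (W : normedModType R).

(* Meant for U open and W finite-dimensional: all iterated directional
   derivatives of order at most k exist and are continuous on U. *)
Fixpoint real_class_C (k : nat) (U : set W) (f : W -> R) : Prop :=
  (forall x, U x -> {for x, continuous f}) /\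
  if k is k'.+1 then
    forall v, (forall x, U x -> derivable f x v) /\ real_class_C k' U ('D_v f)
  else True.

Definition class_C (k : nat) (U : set W) (f : W -> R[i]) :=
  real_class_C k U (fun x => complex.Re (f x)) /\
  real_class_C k U (fun x => complex.Im (f x)).

End ClassCk.

(* Main.v *)
(* A PL-constructible function is constant on the cells of a finite affine
   arrangement. Expanding 1[y > 0] = 1[y >= 0] - 1[y = 0] on each cell writes phi
   as a combination of indicators of closed polyhedra P_i contained in supp phi,
   so the pushforward of phi by xi is the combination of the indicators of the
   intervals xi(P_i) as soon as the slices of supp phi are compact.
   If the sublevel sets of xi on P_i are bounded, then xi attains its minimum on
   P_i at a vertex. Inside a chamber of the arrangement of the hyperplanes
   {xi | xi(v) = xi(w)}, for v and w distinct vertices of the same P_i, the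
   minimizing vertex does not depend on xi; hence the endpoints of xi(P_i) are
   linear in xi, and T_kappa[phi] is a combination of primitives of kappa
   evaluated at linear forms in xi. *)
From HB Require Import structures.
Require Import Defs.
From mathcomp Require Import all_boot all_order all_algebra.
From mathcomp Require Import complex ring lra.
From mathcomp Require Import all_classical all_reals all_analysis.
Import Order.TTheory GRing.Theory Num.Theory.
Import numFieldNormedType.Exports passmx.
Set Implicit Arguments.
Unset Strict Implicit.
Local Open Scope classical_set_scope.
Local Open Scope ring_scope.


(** * Linear maps and compactness in normed finite-dimensional spaces *)

Section Topology.
Variables (R : realType).

Lemma normedvect_normE (V : vectType R) (x : normedvect V) : `|x| = `|coords x|.
Proof. by []. Qed.

Lemma coordsE (V : vectType R) (x : V) :
  x = \sum_i coords x 0 i *: (vbasis (fullv : {vspace V}))`_i.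
Proof. by rewrite -[LHS](rVofK (vbasisP (fullv : {vspace V}))). Qed.

Lemma normr_coord (V : vectType R) (x : normedvect V) i :
  `|coords x 0 i| <= `|x|.
Proof.
rewrite normedvect_normE [leRHS]mx_normE.
exact: (le_bigmax _ (fun i : 'I_1 * 'I__ => `|(coords x) i.1 i.2|%:nng) (0, i)).
Qed.

Lemma linear_le_norm (V : vectType R) (N : normedModType R)
    (f : {linear normedvect V -> N}) :
  exists2 M, 0 <= M & forall x, `|f x| <= M * `|x|.
Proof.
exists (\sum_(i < \dim {:V}) `|f ((vbasis (fullv : {vspace V}))`_i)|).
  by apply: sumr_ge0 => i _.
move=> x; rewrite {1}(coordsE x) linear_sum mulr_suml.
apply: (le_trans (ler_norm_sum _ _ _)); apply: ler_sum => i _.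
by rewrite linearZ normrZ mulrC ler_wpM2l// normr_coord.
Qed.

Lemma linear_normedvect_continuous (V : vectType R) (N : normedModType R)
    (f : {linear normedvect V -> N}) : continuous f.
Proof.
apply: bounded_linear_continuous.
have [M M0 fM] := linear_le_norm f.
exists (M * 1); split; first by rewrite num_real.
move=> y My.
have : \forall x \near (0 : normedvect V), `|x| <= 1 by exact: nbhs0_le.
apply: filterS => x x1.
by apply: (le_trans (fM x)); apply: ltW; apply: le_lt_trans My; rewrite ler_wpM2l.
Qed.


(** The inverse of [coords] is an isometry from row vectors, so Heine-Borel for row vectors carries
    over. *)
Lemma bounded_closed_compact_vect (V : vectType R) (A : set (normedvect V)) :
  closed A -> (exists M, forall x, A x -> `|x| <= M) -> compact A.
Proof.
move=> Acl [M AM].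
have vecofE (v : 'rV_(\dim {:V})) :
    coords (vecof (vbasis fullv) v) = v.
  by rewrite /coords vecofK// vbasisP.
pose vo : {linear 'rV[R]_(\dim {:V}) -> normedvect V} :=
  vecof (vbasis (fullv : {vspace V})).
have vo_norm v : `|vo v| = `|v| by rewrite [LHS]normedvect_normE vecofE.
have vcont : continuous vo.
  apply: bounded_linear_continuous; exists 1; split=> // y y1.
  have : \forall x \near (0 : 'rV[R]_(\dim {:V})), `|x| <= 1 by exact: nbhs0_le.
  apply: filterS => v v1.
  by apply: le_trans (ltW y1); rewrite vo_norm.
have -> : A = vo @` (vo @^-1` A).
  apply/seteqP; split=> [x Ax|_ [v Av <-//]].
  by exists (coords x); rewrite /= rVofK// vbasisP.
apply: continuous_compact; first exact: continuous_subspaceT.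
apply: bounded_closed_compact; last by apply: preimage_closed.
exists M; split=> [|y My v /= /AM]; first by rewrite num_real.
by rewrite vo_norm => vM; apply: le_trans (ltW My).
Qed.

Lemma compact_bounded_vect (V : vectType R) (A : set (normedvect V)) :
  compact A -> exists M, forall x, A x -> `|x| <= M.
Proof.
move=> /compact_bounded [M [_ AM]]; exists (M + 1) => x Ax.
by apply: (AM (M + 1)) => //; rewrite ltrDl.
Qed.

Lemma dual_continuous (V : vectType R) (xi : dual V) :
  continuous (xi : normedvect V -> R).
Proof. exact: (@linear_normedvect_continuous V R^o). Qed.

Definition eval_fun (V : vectType R) (v : V) (xi : dual V) : R^o := xi v.

Lemma eval_fun_linear (V : vectType R) (v : V) : linear (eval_fun v).
Proof. by move=> a f g; rewrite /eval_fun add_lfunE scale_lfunE. Qed.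

HB.instance Definition _ (V : vectType R) (v : V) :=
  GRing.isLinear.Build R (dual V) R^o _ (eval_fun v) (eval_fun_linear v).

(** The canonical map to the bidual; through it a vector of [V] bounds a half-space of the dual
    space. *)
Definition eval_at (V : vectType R) (v : V) : dual (dual V) :=
  linfun (eval_fun v).

Lemma eval_atE (V : vectType R) (v : V) (xi : dual V) : eval_at v xi = xi v.
Proof. by rewrite lfunE. Qed.

Lemma dual_eval_continuous (V : vectType R) (v : V) :
  continuous (fun xi : normedvect (dual V) => (xi : dual V) v : R).
Proof.
move=> xi; rewrite (_ : (fun _ => _) = (eval_at v : normedvect (dual V) -> R)).
  exact: dual_continuous.
by apply/funext => z; rewrite eval_atE.
Qed.

Definition coord_form (V : vectType R) (i : 'I_(\dim {:V})) : dual V :=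
  linfun (coord (vbasis fullv) i).

Lemma coord_formE (V : vectType R) (i : 'I_(\dim {:V})) (x : V) :
  coord_form i x = coords x 0 i.
Proof. by rewrite lfunE mxE. Qed.

Lemma coords_eq0 (V : vectType R) (x : V) : (forall i, coords x 0 i = 0) -> x = 0.
Proof.
by move=> x0; rewrite (coordsE x) big1// => i _; rewrite x0 scale0r.
Qed.

Lemma dual_separates (V : vectType R) (x : V) :
  x != 0 -> exists xi : dual V, xi x != 0.
Proof.
move=> /eqP x0; apply: contrapT => nxi; apply: x0; apply: coords_eq0 => i.
apply: contrapT => /eqP xi0; apply: nxi; exists (coord_form i).
by rewrite coord_formE.
Qed.

End Topology.

(** * Closed polyhedra *)

Section Affine.
Variables (R : realType) (W : vectType R).
Local Notation d := (\dim {:W}).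

(* Index 0 stands for the constant term, index k + 1 for the k-th coordinate. *)
Definition affine_index (i : 'I_d.+1) : {ffun 'I_d -> nat} :=
  if unlift ord0 i is Some k then [ffun j => (k == j) : nat] else [ffun=> 0].

Definition affine_coef (l : dual W) (y : R) (i : 'I_d.+1) : R :=
  if unlift ord0 i is Some k then l (vbasis fullv)`_k else y.

Definition affine_series (l : dual W) (y : R) (alpha : {ffun 'I_d -> nat}) : R :=
  \sum_i (alpha == affine_index i)%:R * affine_coef l y i.

Lemma affine_series_value (l : dual W) (y : R) (h : W) :
  \sum_i affine_coef l y i * monomial h (affine_index i) = y + l h.
Proof.
rewrite big_ord_recl /affine_coef /affine_index unlift_none; congr (_ + _).
  by rewrite /monomial big1 ?mulr1// => i _; rewrite ffunE expr0.
rewrite [in RHS](coordsE h) linear_sum; apply: eq_bigr => k _.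
rewrite liftK linearZ mulrC; congr (_ * _).
rewrite /monomial (bigD1 k)//= ffunE eqxx expr1 big1 ?mulr1// => i /negPf ik.
by rewrite ffunE eq_sym ik expr0.
Qed.

(** The Taylor expansion at [a] stops at degree one: constant term [l a - c], linear coefficients
    the values of [l] on the basis. Any radius would do. *)
Lemma affine_analytic (l : dual W) (c : R) (a : W) :
  real_analytic_at (fun x => l x - c) a.
Proof.
exists 1, (affine_series l (l a - c)); split=> // h _; split.
  (* Each [b i] lives on a single multi-index, so the absolute series is dominated by finitely many
     one-point sums. *)
  pose b i (alpha : {ffun 'I_d -> nat}) : \bar R :=
    if alpha \in [set affine_index i] then
      `|affine_coef l (l a - c) i * monomial h alpha|%:E else 0%E.
  have b0 i alpha : (0 <= b i alpha)%E by rewrite /b; case: ifP.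
  apply: (@le_lt_trans _ _ (\esum_(alpha in setT) \sum_i b i alpha)%E).
    apply: le_esum => alpha _; rewrite /affine_series mulr_suml /=.
    apply: (@le_trans _ _ (\sum_i `|(alpha == affine_index i)%:R *
       affine_coef l (l a - c) i * monomial h alpha|)%:E).
      by rewrite lee_fin ler_norm_sum.
    rewrite -sumEFin; apply: lee_sum => i _; rewrite /b.
    case: ifPn => [|/negP ai]; first by rewrite inE => ->; rewrite eqxx mul1r.
    by case: eqP ai => [->|_ _]; rewrite ?inE//= !mul0r normr0.
  rewrite esum_sum// lte_sum_pinfty// => i _; rewrite -esum_mkcond esum_set1//.
  exact: ltry.
rewrite [l (a + h)]linearD addrAC -affine_series_value.
(* The exponents are 0 and 1, so every box with [N >= 2] already contains all nonzero terms. *)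
apply: cvg_near_cst; exists 2%N => // N N2.
have {N2}[N' ->] : exists N', N = N'.+2 by case: N N2 => [|[|N']]//; exists N'.
under eq_bigr do rewrite /affine_series mulr_suml.
rewrite exchange_big; apply: eq_bigr => i _ /=.
have affN j : (affine_index i j < N'.+2)%N.
  by rewrite /affine_index; case: unlift => [k|]; rewrite ffunE//; case: eqP.
pose alpha0 : {ffun 'I_d -> 'I_N'.+2} := [ffun j => inord (affine_index i j)].
have alpha0E : [ffun j => val (alpha0 j)] = affine_index i.
  by apply/ffunP => j; rewrite !ffunE /= inordK.
rewrite (bigD1 alpha0)//= alpha0E eqxx mul1r big1 ?addr0// => alpha nalpha.
case: eqP => [alphaE|_]; last by rewrite !mul0r.
case/eqP: nalpha; apply/ffunP => j; apply: val_inj.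
by rewrite ffunE /= inordK// -alphaE ffunE.
Qed.

End Affine.

(** * Convexity, contractibility and subanalyticity of closed polyhedra *)

Section Polyhedra.
Variables (R : realType).

(** The forms may be zero, which allows padding by trivial inequalities and a common index type for
    several polyhedra. *)
Definition cpoly (V : vectType R) (J : finType) (l : J -> dual V) (c : J -> R) :
    set (normedvect V) :=
  [set x : V | forall j, c j <= l j x].

Lemma cpoly_closed (V : vectType R) (J : finType) (l : J -> dual V) (c : J -> R) :
  closed (cpoly l c).
Proof.
rewrite (_ : cpoly l c = \bigcap_j [set x : normedvect V | c j <= (l j : dual V) x]).
  apply: closed_bigI => j _.
  rewrite (_ : [set x | _] = (l j : normedvect V -> R) @^-1` [set t | c j <= t])//.
  by apply: preimage_closed; [move=> x _; exact: dual_continuous|exact: closed_ge].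
by apply/seteqP; split=> [x Px j _|x Px j]; [exact: Px|exact: (Px j I)].
Qed.

Lemma cpoly_convex (V : vectType R) (J : finType) (l : J -> dual V) (c : J -> R)
    (x y : V) (t : R) :
  0 <= t <= 1 -> cpoly l c x -> cpoly l c y -> cpoly l c ((1 - t) *: x + t *: y).
Proof.
move=> /andP[t0 t1] Px Py j; rewrite linearD !linearZ/=.
have -> : c j = (1 - t) * c j + t * c j by rewrite -mulrDl subrK mul1r.
by apply: lerD; apply: ler_wpM2l; rewrite ?subr_ge0.
Qed.

(** The straight-line homotopy towards [x0] stays in [K]. *)
Lemma contractible_convex (V : vectType R) (K : set (normedvect V)) (x0 : V) :
  K x0 -> (forall (x y : V) (t : R), 0 <= t <= 1 -> K x -> K y ->
    K ((1 - t) *: x + t *: y)) -> contractible R K.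
Proof.
move=> Kx0 Kconv.
exists x0, (fun z => (1 - z.2) *: z.1 + z.2 *: (x0 : normedvect V)); split=> //.
- apply: continuous_subspaceT => -[x t].
  apply: cvgD; last by apply: cvgZr_tmp; exact: cvg_snd.
  by apply: cvgZ; [apply: cvgB; [exact: cvg_cst|exact: cvg_snd]|exact: cvg_fst].
- by move=> x t Kx t01; exact: Kconv.
- by move=> x _ /=; rewrite subr0 scale1r scale0r addr0.
- by move=> x _ /=; rewrite subrr scale0r scale1r add0r.
Qed.

(** Stratify by the set of tight constraints: on each stratum these are equations and the others are
    strict inequalities. *)
Lemma cpoly_semianalytic (V : vectType R) (J : finType) (l : J -> dual V)
    (c : J -> R) : semianalytic (cpoly l c).
Proof.
move=> a; exists setT, #|{ffun J -> bool}|, #|J|, #|J|.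
pose s (i : 'I_#|{ffun J -> bool}|) (j : 'I_#|J|) := enum_val i (enum_val j).
exists (fun i j x => (if s i j then l (enum_val j) else 0) x -
   (if s i j then c (enum_val j) else 0)).
exists (fun i j x => (if s i j then 0 else l (enum_val j)) x -
   (if s i j then -1 else c (enum_val j))).
split=> //; [exact: openT|by move=> i j x _; exact: affine_analytic..|].
rewrite setIT setTI; apply/seteqP; split=> [x Px|x [i _ [/= fx gx]] j].
  pose e := [ffun j => l j x == c j]; exists (enum_rank e) => //=.
  split=> j; rewrite /s enum_rankK ffunE; case: eqP => [H|/eqP H].
  - by rewrite H subrr.
  - by rewrite zero_lfunE subrr.
  - by rewrite zero_lfunE sub0r opprK.
  - by rewrite subr_gt0 lt_def H; exact: Px.
have := gx (enum_rank j); have := fx (enum_rank j).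
rewrite /s !enum_rankK; case: ifP => _.
  by move=> /eqP; rewrite subr_eq0 => /eqP ->.
by rewrite subr_gt0 => _ /ltW.
Qed.

Definition inl_fun (V : vectType R) (m : nat) (x : V) : (V * 'rV[R]_m)%type := (x, 0).
Lemma inl_fun_linear (V : vectType R) m : linear (@inl_fun V m).
Proof. by move=> a x y; apply: injective_projections; rewrite /= ?scaler0 ?addr0. Qed.
HB.instance Definition _ (V : vectType R) m :=
  GRing.isLinear.Build R V (V * 'rV[R]_m)%type _ (@inl_fun V m) (@inl_fun_linear V m).

Definition fst_fun (V : vectType R) (m : nat) (x : (V * 'rV[R]_m)%type) : V := x.1.
Lemma fst_fun_linear (V : vectType R) m : linear (@fst_fun V m).
Proof. by []. Qed.
HB.instance Definition _ (V : vectType R) m :=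
  GRing.isLinear.Build R (V * 'rV[R]_m)%type V _ (@fst_fun V m) (@fst_fun_linear V m).

(** A compact polyhedron is the projection of its copy in the product with the zero space ['rV_0],
    which is again a compact polyhedron. *)
Lemma cpoly_subanalytic (V : vectType R) (J : finType) (l : J -> dual V)
    (c : J -> R) : compact (cpoly l c) -> subanalytic (cpoly l c).
Proof.
move=> cP a; exists setT, 0%N.
exists (@cpoly (V * 'rV[R]_0)%type J (fun j => (l j \o linfun (@fst_fun V 0))%VF) c).
have BE : @cpoly (V * 'rV[R]_0)%type J (fun j => (l j \o linfun (@fst_fun V 0))%VF) c
    = inl_fun 0 @` cpoly l c.
  apply/seteqP; split=> [[x y] Pxy|_ [x Px <-] j].
    exists x; last by rewrite /inl_fun; congr (_, _); apply/rowP => -[].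
    by move=> j; have := Pxy j; rewrite comp_lfunE lfunE.
  by rewrite comp_lfunE lfunE; exact: Px.
split=> //; [exact: openT|exact: cpoly_semianalytic| |].
  have BC : compact (inl_fun 0 @` cpoly l c : set (normedvect (V * 'rV[R]_0)%type)).
    apply: continuous_compact => //; apply: continuous_subspaceT.
    exact: (@linear_normedvect_continuous R V (normedvect (V * 'rV[R]_0)%type)).
  have BCl := compact_closed (@norm_hausdorff _ (normedvect (V * 'rV[R]_0)%type)) BC.
  by rewrite BE -(iffLR (closure_id _) BCl).
rewrite setIT BE; apply/seteqP; split=> [x Px|_ [_ [x Px <-] <-]]//.
by exists (x, 0) => //; exists x.
Qed.

End Polyhedra.

(** * Decomposition of PL-constructible functions *)

Section Decomposition.
Variables (R : realType).

Lemma half_space_sign (V : vectType R) (H : set (normedvect V)) :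
  half_space H -> exists lc : dual V * R, forall x y : V,
    Num.sg (lc.1 x - lc.2) = Num.sg (lc.1 y - lc.2) -> H x -> H y.
Proof.
move=> [l [c [_ lc]]]; exists (l, c) => x y /= sxy.
case: lc => -> /=; rewrite -!(subr_ge0 c, subr_gt0 c).
  by rewrite -sgr_ge0 sxy sgr_ge0.
by rewrite -sgr_gt0 sxy sgr_gt0.
Qed.

(** Collect the bounding hyperplanes of all pieces: membership in an open or closed half-space
    depends only on a sign, so points with equal sign vectors lie in the same piece. *)
Lemma PL_constructible_sign (V : vectType R) (phi : normedvect V -> int) :
  PL_constructible phi ->
  exists (J : finType) (l : J -> dual V) (c : J -> R), forall x y : V,
    (forall j, Num.sg (l j x - c j) = Num.sg (l j y - c j)) -> phi x = phi y.
Proof.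
move=> [n [P [[Pcover _ _] Ppoly Pcst]]].
have Psign i : exists lc : {k : nat & 'I_k -> dual V * R}, forall x y : V,
    (forall a, Num.sg ((projT2 lc a).1 x - (projT2 lc a).2) =
               Num.sg ((projT2 lc a).1 y - (projT2 lc a).2)) ->
    P i x -> P i y.
  have [k [H [Hhalf ->]]] := Ppoly i.
  have [lc lcP] := choice (fun a => half_space_sign (Hhalf a)).
  exists (existT _ k lc) => x y sxy Px a _.
  exact: (lcP a x y (sxy a) (Px a I)).
have [lc lcP] := choice Psign.
pose f (j : {i : 'I_n & 'I_(projT1 (lc i))}) := projT2 (lc (tag j)) (tagged j).
exists {i : 'I_n & 'I_(projT1 (lc i))}, (fun j => (f j).1), (fun j => (f j).2).
move=> x y sxy; have : [set: V] x by [].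
rewrite -Pcover => -[i _ Pix]; apply: (Pcst i) => //.
by apply: lcP Pix => a; exact: (sxy (Tagged _ a)).
Qed.

(* [None], [Some true] and [Some false] encode the conditions [y = 0], [y > 0]
   and [y < 0] in [sign_code], and [y = 0], [y >= 0] and [y <= 0] in [sat]. *)
Definition sign_code (y : R) : option bool := if y == 0 then None else Some (0 < y).

Definition sat (o : option bool) (y : R) : bool :=
  match o with None => y == 0 | Some true => 0 <= y | Some false => y <= 0 end.

(* [e] selects a term in the expansion 1[y > 0] = 1[y >= 0] - 1[y = 0]; for the
   condition y = 0 the term [e = false] has weight 0. *)
Definition sat_kind (o : option bool) (e : bool) : option bool :=
  if e then None else o.

Definition sat_weight (o : option bool) (e : bool) : int :=
  match o with None => e%:R | Some _ => if e then -1 else 1 end.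

Lemma sign_code_sat (o : option bool) (y : R) :
  (sign_code y == o)%:R =
  \sum_(e : bool) sat_weight o e * (sat (sat_kind o e) y)%:R :> int.
Proof.
rewrite big_bool /sign_code; case: o => [[]|] /=; case: ltgtP => //=.
Qed.

(** Moving from the closed condition towards a point of the open one enters the open one at once;
    thus the closed polyhedra of the expansion lie in the closure of their cell. *)
Lemma sign_code_segment (o : option bool) (e : bool) (y y0 t : R) :
  0 < t <= 1 -> sat_weight o e != 0 -> sat (sat_kind o e) y ->
  sign_code y0 = o -> sign_code ((1 - t) * y + t * y0) = o.
Proof.
move=> /andP[t0 t1] we sy y0o; subst o.
have t1' : 0 <= 1 - t by rewrite subr_ge0.
move: we sy; rewrite /sign_code; case: ltgtP => [y00|y00|<-]; last first.
- by case: e => //= _ /eqP ->; rewrite !mulr0 addr0 eqxx.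
- move=> _ sy; have y0' : y <= 0 by case: e sy => //= /eqP ->.
  suff : (1 - t) * y + t * y0 < 0 by case: ltgtP.
  by rewrite ltr_wnDl// ?mulr_ge0_le0// nmulr_llt0.
- move=> _ sy; have y0' : 0 <= y by case: e sy => //= /eqP ->.
  suff : 0 < (1 - t) * y + t * y0 by case: ltgtP.
  by rewrite ltr_wpDl// ?mulr_ge0// mulr_gt0.
Qed.

Lemma prod_natr_forall (S : comPzSemiRingType) (J : finType) (b : J -> bool) :
  \prod_j (b j)%:R = [forall j, b j]%:R :> S.
Proof.
case: forallP => [bT|/forallP]; first by rewrite big1// => j _; rewrite bT.
by rewrite negb_forall => /existsP[j /negPf bj]; rewrite (bigD1 j)//= bj mul0r.
Qed.

(* Every condition [sat k (l x - c)] is coded by the two inequalities indexed by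
   [b : bool], an inequality that is not needed being replaced by 0 <= 0. *)
Definition sat_active (k : option bool) (b : bool) := (k == None) || (k == Some b).

Definition sat_form (V : vectType R) (k : option bool) (b : bool)
    (l : dual V) : dual V :=
  if sat_active k b then (if b then l else - l) else 0.

Definition sat_bound (k : option bool) (b : bool) (c : R) : R :=
  if sat_active k b then (if b then c else - c) else 0.

Lemma cpoly_sat (V : vectType R) (J : finType) (k : J -> option bool)
    (l : J -> dual V) (c : J -> R) (x : V) :
  cpoly (fun jb : J * bool => sat_form (k jb.1) jb.2 (l jb.1))
        (fun jb => sat_bound (k jb.1) jb.2 (c jb.1)) x <->
  forall j, sat (k j) (l j x - c j).
Proof.
rewrite /sat_form /sat_bound /sat_active; split=> [Px j|kx [j b]].
  have /= := Px (j, true); have /= := Px (j, false).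
  case: (k j) => [[]|] /=; rewrite ?zero_lfunE ?opp_lfunE ?lerN2.
  - by rewrite subr_ge0.
  - by rewrite subr_le0.
  - by rewrite eq_le subr_ge0 subr_le0 => -> ->.
have /= := kx j; case: (k j) => [[]|] /=; case: b;
  rewrite ?zero_lfunE ?opp_lfunE ?lerN2 ?subr_ge0 ?subr_le0//.
- by rewrite subr_eq0 => /eqP ->.
- by rewrite subr_eq0 => /eqP ->.
Qed.

(** Terms are indexed by a sign pattern and, for each hyperplane, a choice of summand in the
    expansion of the sign condition. A term with nonzero coefficient lies in the closure of a
    nonempty cell where [phi] is nonzero. *)
Lemma PL_constructible_decomposition (V : vectType R) (phi : normedvect V -> int) :
  PL_constructible phi ->
  exists (I J : finType) (m : I -> int) (l : I -> J -> dual V) (c : I -> J -> R),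
    (forall x, phi x = \sum_i m i * \1_(cpoly (l i) (c i)) x) /\
    forall i, m i != 0 -> cpoly (l i) (c i) `<=` supp phi.
Proof.
move=> /PL_constructible_sign [J [l [c sgnP]]].
pose s (x : V) : {ffun J -> option bool} := [ffun j => sign_code (l j x - c j)].
have sP x y : s x = s y -> phi x = phi y.
  move=> sxy; apply: sgnP => j.
  have := congr1 (fun f : {ffun J -> option bool} => f j) sxy.
  rewrite !ffunE /sign_code.
  case: (ltgtP (l j x - c j) 0) => [hx|hx|->];
    case: (ltgtP (l j y - c j) 0) => [hy|hy|->] //= _.
    by rewrite !ltr0_sg.
  by rewrite !gtr0_sg.
(* [v sigma] is the value of [phi] on the cell [sigma], and 0 on an empty cell, so that a nonzero
   value provides a point of the cell. *)
have /choice[v vP] (sigma : {ffun J -> option bool}) : exists vs,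
    (forall x, s x = sigma -> vs = phi x) /\ (vs != 0 -> exists x, s x = sigma).
  have [[x sx]|nx] := pselect (exists x, s x = sigma).
    by exists (phi x); split=> [y sy|_]; [apply: sP; rewrite sx sy|exists x].
  by exists 0; split=> [y sy|]; [case: nx; exists y|rewrite eqxx].
pose k (i : {ffun J -> option bool} * {ffun J -> bool}) j := sat_kind (i.1 j) (i.2 j).
exists ({ffun J -> option bool} * {ffun J -> bool})%type, (J * bool)%type.
exists (fun i : {ffun J -> option bool} * {ffun J -> bool} =>
  v i.1 * \prod_j sat_weight (i.1 j) (i.2 j)).
exists (fun i jb => sat_form (k i jb.1) jb.2 (l jb.1)).
exists (fun i jb => sat_bound (k i jb.1) jb.2 (c jb.1)).
split=> [x|[sigma f] /= m0 x Px].
  have indE i : \1_(cpoly (fun jb : J * bool => sat_form (k i jb.1) jb.2 (l jb.1))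
      (fun jb => sat_bound (k i jb.1) jb.2 (c jb.1))) x =
      \prod_j (sat (k i j) (l j x - c j))%:R :> int.
    rewrite indicE prod_natr_forall; congr (nat_of_bool _)%:R.
    by apply/idP/forallP; [rewrite inE => /cpoly_sat|rewrite inE => ?; apply/cpoly_sat].
  under eq_bigr do rewrite indE -mulrA -big_split/=.
  rewrite -(pair_bigA _ (fun (sigma : {ffun J -> option bool}) (f : {ffun J -> bool}) =>
     v sigma * \prod_j (sat_weight (sigma j) (f j) *
     (sat (sat_kind (sigma j) (f j)) (l j x - c j))%:R)))/=.
  (* Summing over all choices undoes the expansion: the product of sums is the indicator of the cell
     [sigma], and only [sigma = s x] survives. *)
  under eq_bigr => sigma _.
    rewrite -mulr_sumr -(bigA_distr_bigA (fun j e => sat_weight (sigma j) e *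
       (sat (sat_kind (sigma j) e) (l j x - c j))%:R))/=.
    under eq_bigr do rewrite -sign_code_sat.
    rewrite prod_natr_forall (_ : [forall j, _] = (s x == sigma)); last first.
      apply/forallP/eqP => [sx|<- j]; last by rewrite ffunE.
      by apply/ffunP => j; rewrite ffunE; apply/eqP.
    over.
  rewrite (bigD1 (s x))//= eqxx mulr1 big1 ?addr0.
    by rewrite ((vP (s x)).1 x).
  by move=> sigma /negPf; rewrite eq_sym => ->; rewrite mulr0.
move: m0; rewrite mulf_eq0 negb_or => /andP[/[dup] v0 /(vP sigma).2 [x0 sx0]].
move=> /prodf_neq0 w0.
have phi0 : phi x0 != 0 by rewrite -((vP sigma).1 x0 sx0).
move=> B Bx.
(* Points of the segment from [x] to [x0] close to [x] lie in the cell of [x0], so [x] is in the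
   closure of that cell. *)
have gcvg : ((1 - t) *: x + t *: (x0 : normedvect V)) @[t --> (0:R)^'+] --> x.
  rewrite -[X in _ --> X](_ : (1 - 0) *: x + (0 : R) *: (x0 : normedvect V) = x);
    last first.
    by rewrite subr0 scale1r scale0r addr0.
  apply: cvg_at_right_filter; apply: cvgD; last by apply: cvgZr_tmp; exact: cvg_id.
  by apply: cvgZr_tmp; apply: cvgB; [exact: cvg_cst|exact: cvg_id].
have [t /= [Bt [t0 t1]]] : exists t, B ((1 - t) *: x + t *: (x0 : normedvect V)) /\
    0 < t /\ t <= 1.
  apply: (@filter_ex _ (0:R)^'+); apply: filterI; first exact: gcvg.
  by apply: filterI; [exact: nbhs_right_gt|exact: nbhs_right_le].
exists ((1 - t) *: x + t *: (x0 : normedvect V)); split=> //=.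
rewrite (sP _ x0)// sx0; apply/ffunP => j; rewrite ffunE.
have -> : l j ((1 - t) *: x + t *: x0) - c j =
    (1 - t) * (l j x - c j) + t * (l j x0 - c j).
  by rewrite linearD !linearZ/= -!/(_ *: _)/GRing.scale/=; ring.
apply: (@sign_code_segment _ (f j)); rewrite ?t0 ?t1 ?w0//.
  by move/cpoly_sat: Px; apply.
by rewrite -sx0 ffunE.
Qed.

End Decomposition.

(** * Vertices *)

Definition sublevel_bounded (R : realType) (V : vectType R)
    (P : set (normedvect V)) (xi : dual V) :=
  forall t, exists M, forall x : normedvect V, P x -> xi x <= t -> `|x| <= M.

Section Vertices.
Variables (R : realType) (V : vectType R) (J : finType).
Variables (l : J -> dual V) (c : J -> R).
Local Notation P := (cpoly l c).

(** A basic solution: the second clause makes the equations of [S] determine [v], which may lie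
    outside [P]. *)
Definition vertex_of (S : {set J}) (v : V) :=
  (forall j, j \in S -> l j v = c j) /\
  (forall d : V, (forall j, j \in S -> l j d = 0) -> d = 0).

(** The default 0 for a set [S] without basic solution is harmless: it only adds a point to the
    finite list to be compared. *)
Definition vertex (S : {set J}) : V := xget 0 (vertex_of S).

Lemma vertexE (S : {set J}) (v : V) : vertex_of S v -> vertex S = v.
Proof.
move=> [Sv Sker]; rewrite /vertex; case: xgetP => [_ -> [Su _]|/(_ v)[]//].
apply/eqP; rewrite -subr_eq0; apply/eqP; apply: Sker => j jS.
by rewrite linearB /= Su// Sv// subrr.
Qed.

Definition tight (x : V) : {set J} := [set j | l j x == c j].

Lemma dual_line (xi : dual V) (x d : V) (t : R) : xi (x + t *: d) = xi x + t * xi d.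
Proof. by rewrite linearD linearZ. Qed.

(* Moving from x along d keeps the tight constraints tight and does not increase
   xi; boundedness forces the ray to hit another facet of P. *)
Lemma exit_facet (xi : dual V) (x d : V) :
  P x -> d != 0 -> (forall j, j \in tight x -> l j d = 0) -> xi d <= 0 ->
  (exists M, forall y : normedvect V, P y -> xi y <= xi x -> `|y| <= M) ->
  exists y, [/\ P y, xi y <= xi x & tight x \proper tight y].
Proof.
move=> Px d0 tightd xid [M Mbnd].
have xi_le (t : R) : 0 <= t -> xi (x + t *: d) <= xi x.
  by move=> t0; rewrite dual_line gerDl mulr_ge0_le0.
have [j0 j0d] : exists j, l j d < 0.
  apply: contrapT => nj.
  have dge0 j : 0 <= l j d by rewrite leNgt; apply/negP => jd; apply: nj; exists j.
  have dn0 : 0 < `|d : normedvect V| by rewrite normr_gt0.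
  (* Chosen so that [t *: d] is too long for [x + t *: d] to have norm at most [M]. *)
  pose t := (`|M| + `|x : normedvect V| + 1) / `|d : normedvect V|.
  have t0 : 0 <= t by rewrite divr_ge0// !addr_ge0.
  have Pxt : P (x + t *: d).
    by move=> j; rewrite dual_line (le_trans (Px j))// lerDl mulr_ge0.
  have := Mbnd _ Pxt (xi_le t t0).
  apply/negP; rewrite -ltNge.
  have td : `|t *: (d : normedvect V)| = `|M| + `|x : normedvect V| + 1.
    by rewrite normrZ ger0_norm// divfK// gt_eqF.
  have := ler_normB (x + t *: d : normedvect V) x.
  rewrite addrAC subrr add0r td => h.
  by apply: le_lt_trans (ler_norm M) _; lra.
(* [t j] is the time at which the ray reaches the facet [j]; the first such time is taken among the
   decreasing constraints. *)
pose t j := (l j x - c j) / (- l j d).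
case: (@arg_minP _ _ _ j0 (fun j => l j d < 0) t j0d) => j1 j1d j1min.
have t0 : 0 <= t j1 by rewrite divr_ge0// ?subr_ge0// oppr_ge0 ltW.
exists (x + t j1 *: d); split; [|exact: xi_le|].
  move=> j; rewrite dual_line; have [jd|jd] := ltP (l j d) 0; last first.
    by rewrite (le_trans (Px j))// lerDl mulr_ge0.
  by have := j1min _ jd; rewrite [leRHS]/t ler_pdivlMr ?oppr_gt0//; lra.
apply/properP; split.
  apply/fintype.subsetP => j; rewrite !inE => jx; rewrite dual_line tightd ?inE//.
  by rewrite mulr0 addr0.
exists j1; rewrite inE.
  by rewrite dual_line /t invrN mulrN mulNr divfK ?(lt_eqF j1d)// subKr.
by apply/negP => j1x; have := j1d; rewrite tightd ?inE// ltxx.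
Qed.

(** Induction on the number of constraints that are not tight: unless the tight ones already
    determine [x], [exit_facet] gives a point with more of them and no larger value. *)
Lemma vertex_descent (xi : dual V) (x : V) :
  P x -> (exists M, forall y : normedvect V, P y -> xi y <= xi x -> `|y| <= M) ->
  exists S, P (vertex S) /\ xi (vertex S) <= xi x.
Proof.
have [n] := ubnP (#|J| - #|tight x|)%N.
elim: n x => // n IH x; rewrite ltnS => nx Px bnd.
have [vx|nvx] := pselect (vertex_of (tight x) x).
  by exists (tight x); rewrite (vertexE vx).
have [d [d0 dx]] : exists d, d != 0 /\ (forall j, j \in tight x -> l j d = 0).
  apply: contrapT => nd; apply: nvx; split=> [j|d jd]; first by rewrite inE => /eqP.
  by apply: contrapT => /eqP d0; apply: nd; exists d.
(* One of [d] and [- d] does not increase [xi]. *)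
have [e [e0 ex xie]] : exists e, [/\ e != 0, (forall j, j \in tight x -> l j e = 0)
    & xi e <= 0].
  have [xid|/ltW xid] := leP (xi d) 0; first by exists d.
  exists (- d); rewrite oppr_eq0 linearN/= oppr_le0; split=> // j jx.
  by rewrite linearN/= dx// oppr0.
have [y [Py xiy txy]] := exit_facet Px e0 ex xie bnd.
have [|//||S [PS xiS]] := IH y.
- apply: leq_trans nx; apply: ltn_sub2l; last exact: proper_card.
  by apply: leq_trans (max_card (tight y)); exact: proper_card.
- by have [M Mb] := bnd; exists M => z Pz zy; apply: Mb => //; exact: le_trans xiy.
- by exists S; split=> //; exact: le_trans xiy.
Qed.

Definition same_vertex_order (U : set (dual V)) :=
  forall xi xi' S S', U xi -> U xi' ->
    xi (vertex S) <= xi (vertex S') -> xi' (vertex S) <= xi' (vertex S').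

Lemma same_vertex_orderN (U : set (dual V)) :
  same_vertex_order U -> same_vertex_order [set - xi | xi in U].
Proof.
move=> Uord _ _ S S' [xi Uxi <-] [xi' Uxi' <-]; rewrite !opp_lfunE !lerN2.
exact: Uord.
Qed.

(** By [vertex_descent] only the finitely many vertices in [P] compete. The best one for a single
    form of [U] is best for all, as they order the vertices alike. *)
Lemma chamber_min (U : set (dual V)) :
  P !=set0 ->
  same_vertex_order U ->
  (forall xi, U xi -> sublevel_bounded P xi) ->
  exists2 v, P v & forall xi x, U xi -> P x -> xi v <= xi x.
Proof.
move=> [x0 Px0] Uord Ubnd.
have [[xi0 Uxi0]|U0] := pselect (exists xi0, U xi0); last first.
  by exists x0 => // xi x Uxi; case: U0; exists xi.
have [S0 [PS0 _]] := vertex_descent Px0 (Ubnd _ Uxi0 _).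
case: (@arg_minP _ _ _ S0 (fun S => `[< P (vertex S) >]) (fun S => xi0 (vertex S))).
  exact/asboolP.
move=> S1 /asboolP PS1 S1min; exists (vertex S1) => // xi x Uxi Px.
have [S [PS xiS]] := vertex_descent Px (Ubnd _ Uxi _).
apply: le_trans xiS; apply: (Uord xi0) => //.
by apply: S1min; exact/asboolP.
Qed.

Lemma cpoly_ivt (xi : dual V) (x y : V) (t : R) :
  P x -> P y -> xi x <= t <= xi y -> exists z, P z /\ xi z = t.
Proof.
move=> Px Py /andP[xt ty].
have [xy|xy] := eqVneq (xi x) (xi y).
  by exists x; split=> //; apply/eqP; rewrite eq_le xt xy.
have xy0 : 0 < xi y - xi x by rewrite subr_gt0 lt_neqAle xy (le_trans xt).
pose s := (t - xi x) / (xi y - xi x).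
exists ((1 - s) *: x + s *: y); split.
  apply: cpoly_convex => //; rewrite divr_ge0 ?subr_ge0 ?(le_trans xt)//=.
  by rewrite ler_pdivrMr// mul1r lerB.
have -> : xi ((1 - s) *: x + s *: y) = xi x + s * (xi y - xi x).
  by rewrite dual_line linearZ/= /GRing.scale/=; ring.
by rewrite divfK ?gt_eqF// addrC subrK.
Qed.

(** The upper endpoint comes from [chamber_min] for the opposite forms; convexity fills in the
    values between. *)
Lemma chamber_segment (U : set (dual V)) :
  P !=set0 ->
  same_vertex_order U ->
  (exists M, forall y : normedvect V, P y -> `|y| <= M) ->
  exists v w, forall xi t, U xi ->
    (exists x, P x /\ xi x = t) <-> xi v <= t <= xi w.
Proof.
move=> P0 Uord [M bnd].
have [v Pv vmin] := chamber_min P0 Uord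
  (fun xi _ t => ex_intro _ M (fun y Py _ => bnd y Py)).
have [|w Pw wmax] := chamber_min P0 (same_vertex_orderN Uord).
  by move=> xi _ t; exists M => y /bnd.
exists v, w => xi t Uxi; split=> [[x [Px <-]]|]; last exact: cpoly_ivt.
rewrite vmin//= -lerN2 -!opp_lfunE; apply: wmax => //.
by exists xi.
Qed.

(** If [xi] were bounded above on [P], then [P] would be one of its sublevel sets, hence bounded. *)
Lemma chamber_ray (U : set (dual V)) :
  P !=set0 ->
  same_vertex_order U ->
  (forall xi, U xi -> sublevel_bounded P xi) ->
  ~ (exists M, forall y : normedvect V, P y -> `|y| <= M) ->
  exists v, forall xi t, U xi -> (exists x, P x /\ xi x = t) <-> xi v <= t.
Proof.
move=> P0 Uord Ubnd nbnd; have [v Pv vmin] := chamber_min P0 Uord Ubnd.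
exists v => xi t Uxi; split=> [[x [Px <-]]|vt]; first exact: vmin.
have [y Py ty] : exists2 y, P y & t < xi y.
  apply: contrapT => ny; apply: nbnd; have [M Mb] := Ubnd _ Uxi t.
  exists M => y Py; apply: Mb => //; rewrite leNgt; apply/negP => ty.
  by apply: ny; exists y.
by apply: (cpoly_ivt Pv Py); rewrite vt ltW.
Qed.

End Vertices.

(** * Chambers of the dual space *)

Section Chambers.
Variables (R : realType) (V : vectType R) (D : finType) (d : D -> V).

Definition signed_dir (s : D -> bool) (k : D) : V := if s k then d k else - d k.

(** A region of the complement of the hyperplanes [xi (d k) = 0], empty if the signs are
    incompatible. *)
Definition chamber (s : D -> bool) : set (normedvect (dual V)) :=
  [set xi : dual V | forall k, (0 : R) < xi (signed_dir s k)].

Lemma open_dual_gt0 (v : V) :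
  open [set xi : normedvect (dual V) | (0 : R) < (xi : dual V) v].
Proof.
rewrite (_ : [set xi | _] =
  (fun xi : normedvect (dual V) => (xi : dual V) v : R) @^-1` [set t | 0 < t])//.
by apply: open_comp; [move=> xi _; exact: dual_eval_continuous|exact: open_gt].
Qed.

Lemma chamber_open (s : D -> bool) : open (chamber s).
Proof.
rewrite openE => xi xis.
apply: (@filter_forall (normedvect (dual V)) D
  (fun k (eta : dual V) => (0 : R) < eta (signed_dir s k)) (nbhs xi)) => k.
apply: (@open_nbhs_nbhs _ xi [set eta : dual V | (0 : R) < eta (signed_dir s k)]).
by split; [exact: open_dual_gt0|exact: xis].
Qed.

Lemma chamber_cone (s : D -> bool) : cone (chamber s).
Proof.
move=> a xi a0 xis k; rewrite scale_lfunE.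
by apply: mulr_gt0 => //; exact: xis.
Qed.

Lemma chamber_order (s : D -> bool) (xi eta : dual V) (k : D) :
  chamber s xi -> chamber s eta -> 0 <= xi (d k) -> 0 <= eta (d k).
Proof.
move=> /(_ k) + /(_ k); rewrite /signed_dir; case: (s k) => [_ /ltW//|].
by rewrite !linearN/= oppr_gt0 => /lt_geF ->.
Qed.

Hypothesis d_neq0 : forall k, d k != 0.

Lemma chamber_polyhedron (s : D -> bool) : convex_polyhedron (chamber s).
Proof.
exists #|D|, (fun i => [set xi : dual V | (0 : R) < xi (signed_dir s (enum_val i))]).
split=> [i|]; last first.
  apply/seteqP; split=> [xi xis i _|xi H k]; first exact: xis.
  by have := H (enum_rank k) I; rewrite /= enum_rankK.
exists (eval_at (signed_dir s (enum_val i))), 0; split; last first.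
  by right; apply/seteqP; split=> xi /=; rewrite eval_atE.
have sd0 : signed_dir s (enum_val i) != 0.
  by rewrite /signed_dir; case: ifP => _; rewrite ?oppr_eq0.
have [xi xid] := dual_separates sd0.
by apply: contra_neq xid => e0; rewrite -eval_atE e0 zero_lfunE.
Qed.

(** Hyperplanes are avoided one at a time: find a point of [O] off the next one, then shrink [O] to
    its open part off that hyperplane. *)
Lemma generic_dual_dense (r : seq D) (O : set (normedvect (dual V))) :
  open O -> O !=set0 ->
  exists xi : dual V, O xi /\ forall k, k \in r -> xi (d k) != 0.
Proof.
elim: r O => [|k r IH] O Oopen [xi0 Oxi0]; first by exists xi0.
have [xi1 Oxi1 xi1k] : exists2 xi : dual V, O xi & xi (d k) != 0.
  have [xik0|xik0] := eqVneq ((xi0 : dual V) (d k)) 0; last by exists xi0.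
  (* A small push along a form that is nonzero at [d k] leaves the hyperplane but not [O]. *)
  have [eta etak] := dual_separates (d_neq0 k).
  have gcvg : ((xi0 : normedvect (dual V)) + t *: (eta : normedvect (dual V)))
      @[t --> (0:R)^'+] --> xi0.
    rewrite -[X in _ --> X](_ : xi0 + (0 : R) *: (eta : normedvect (dual V)) = xi0).
      apply: cvg_at_right_filter; apply: cvgD; first exact: cvg_cst.
      by apply: cvgZr_tmp; exact: cvg_id.
    by rewrite scale0r addr0.
  have [t /= [Ot t0]] : exists t : R,
      O ((xi0 : normedvect (dual V)) + t *: (eta : normedvect (dual V))) /\ 0 < t.
    apply: (@filter_ex _ (0:R)^'+); apply: filterI; last exact: nbhs_right_gt.
    by apply: gcvg; apply: open_nbhs_nbhs.
  exists (xi0 + t *: eta) => //.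
  by rewrite add_lfunE xik0 add0r scale_lfunE mulf_neq0// gt_eqF.
have := IH (O `&` ([set xi : dual V | (0 : R) < xi (d k)] `|`
  [set xi : dual V | (0 : R) < xi (- d k)])).
case.
- by apply: openI => //; apply: openU; exact: open_dual_gt0.
- exists xi1; split=> //; move: xi1k; rewrite neq_lt => /orP[|]; [right|by left].
  by rewrite /= linearN/= oppr_gt0.
- move=> xi [[Oxi xik] xir]; exists xi; split=> // j.
  rewrite inE => /predU1P[->|]; last exact: xir.
  by case: xik => /=; rewrite ?linearN/= ?oppr_gt0; [move=> /gt_eqF ->|move=> /lt_eqF ->].
Qed.

(** Otherwise the finitely many neighbourhoods of [xi] that miss a chamber would meet in one missing
    all chambers, yet it contains a generic form, which lies in the chamber of its own signs. *)
Lemma chamber_cover (xi : dual V) :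
  exists s : {ffun D -> bool}, closure (chamber s) xi.
Proof.
apply: contrapT => ns.
have /choice[B Bxi] (s : {ffun D -> bool}) : exists B : set (normedvect (dual V)),
    nbhs (xi : normedvect (dual V)) B /\ chamber s `&` B = set0.
  apply: contrapT => nB; apply: ns; exists s => B Bxi.
  by apply/set0P/eqP => sB; apply: nB; exists B.
have Bnear := filter_forall (nbhs_filter (xi : normedvect (dual V)))
  (fun s => (Bxi s).1).
move: Bnear; rewrite nbhsE => -[B0 [Oopen Oxi] OB].
have [|eta [Oeta etad]] := @generic_dual_dense (enum D) B0 Oopen; first by exists xi.
pose s := [ffun k => 0 < eta (d k)].
have [_ sB] := Bxi s; suff : (chamber s `&` B s) eta by rewrite sB.
split; last exact: OB.
move=> k; rewrite /signed_dir ffunE.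
have := etad k; rewrite mem_enum => /(_ isT); rewrite neq_lt => /orP[etak|etak].
  by rewrite (lt_gtF etak) linearN/= oppr_gt0.
by rewrite etak.
Qed.

End Chambers.

(** * Differentiability classes and primitives *)

Section Smoothness.
Variables (R : realType).

Lemma real_class_C_eq (W : normedModType R) (k : nat) (U : set W) (f g : W -> R) :
  open U -> (forall x, U x -> f x = g x) ->
  real_class_C k U f -> real_class_C k U g.
Proof.
move=> Uopen.
have near_eq h1 h2 x : (forall x, U x -> h1 x = h2 x) -> U x -> \near x, h1 x = h2 x.
  by move=> h12 Ux; apply: filterS (open_nbhs_nbhs (conj Uopen Ux)) => y; exact: h12.
have cont_eq h1 h2 : (forall x, U x -> h1 x = h2 x) ->
    (forall x, U x -> {for x, continuous h1}) -> forall x, U x -> {for x, continuous h2}.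
  move=> h12 h1c x Ux; rewrite /prop_for /continuous_at -(h12 x Ux).
  apply: cvg_trans (h1c x Ux); by apply: near_eq_cvg; exact: near_eq.
elim: k f g => [|k IH] f g fg [fc fD]; (split; first exact: cont_eq fc) => //.
move=> v; have [dfv Cfv] := fD v; split=> [x Ux|].
  by apply: near_eq_derivable (dfv x Ux); exact: near_eq.
by apply: IH Cfv => x Ux; apply: near_eq_derive; exact: near_eq.
Qed.

Lemma real_class_C_cst (W : normedModType R) (k : nat) (U : set W) (a : R) :
  open U -> real_class_C k U (fun=> a).
Proof.
move=> Uopen; elim: k a => [|k IH] a;
  (split; first by move=> x _; exact: cvg_cst) => // v.
split=> [x _|]; first exact: derivable_cst.
by apply: real_class_C_eq (IH 0) => // x _; rewrite derive_cst.
Qed.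

Lemma real_class_CD (W : normedModType R) (k : nat) (U : set W) (f g : W -> R) :
  open U -> real_class_C k U f -> real_class_C k U g ->
  real_class_C k U (fun x => f x + g x).
Proof.
move=> Uopen; elim: k f g => [|k IH] f g [fc fD] [gc gD];
  (split; first by move=> x Ux; exact: (continuousD (fc x Ux) (gc x Ux))) => // v.
have [[dfv Cfv] [dgv Cgv]] := (fD v, gD v); split=> [x Ux|].
  exact: (derivableD (dfv x Ux) (dgv x Ux)).
apply: real_class_C_eq (IH _ _ Cfv Cgv) => // x Ux.
by rewrite (deriveD (dfv x Ux) (dgv x Ux)).
Qed.

Lemma real_class_CZ (W : normedModType R) (k : nat) (U : set W) (a : R)
    (f : W -> R) :
  open U -> real_class_C k U f -> real_class_C k U (fun x => a * f x).
Proof.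
move=> Uopen; elim: k f => [|k IH] f [fc fD];
  (split; first by move=> x Ux;
    exact: (continuousM (@cst_continuous _ _ a x) (fc x Ux))) => // v.
have [dfv Cfv] := fD v; split=> [x Ux|].
  exact: (@derivableZ R W R^o f a x v (dfv x Ux)).
apply: real_class_C_eq (IH _ Cfv) => // x Ux.
by rewrite (@deriveZ R W R^o f a x v (dfv x Ux)).
Qed.

Lemma real_class_C_sum (W : normedModType R) (k : nat) (U : set W) (I : Type)
    (r : seq I) (f : I -> W -> R) :
  open U -> (forall i, real_class_C k U (f i)) ->
  real_class_C k U (fun x => \sum_(i <- r) f i x).
Proof.
move=> Uopen fC; elim: r => [|i r IH].
  by under eq_fun do rewrite big_nil; exact: real_class_C_cst.
by under eq_fun do rewrite big_cons; exact: real_class_CD.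
Qed.

(* The difference quotient of [f \o L] at [x] along [v] is, on the nose, that of
   [f] at [L x] along [L v]. *)
Lemma real_class_C_linear (W W' : normedModType R) (k : nat) (U : set W)
    (L : {linear W -> W'}) (f : W' -> R) :
  continuous L -> real_class_C k setT f -> real_class_C k U (f \o L).
Proof.
move=> Lc; elim: k f => [|k IH] f [fc fD];
  (split; first by move=> x Ux; apply: continuous_comp; [exact: Lc|exact: fc]) => // v.
have [dfv Cfv] := fD (L v).
have quotE x : (fun h : R => h^-1 *: ((f \o L \o shift x) (h *: v) - (f \o L) x)) =
    (fun h : R => h^-1 *: ((f \o shift (L x)) (h *: L v) - f (L x))).
  by apply/funext => h /=; rewrite [L (_ + _)]linearD [L (_ *: _)]linearZ.
split=> [x Ux|].
  by have := dfv (L x) I; rewrite /derivable quotE.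
rewrite (_ : 'D_v (f \o L) = 'D_(L v) f \o L); first exact: IH.
by apply/funext => x; rewrite /derive quotE.
Qed.

(** The derivative of [F] along [v] is [v * f]; this is where one order of regularity is gained. *)
Lemma real_class_C_primitive (k : nat) (F f : R -> R) :
  (forall x, derivable F x 1 /\ F^`()%classic x = f x) ->
  real_class_C k setT f -> real_class_C k.+1 setT F.
Proof.
move=> FE fC; have Fdiff x : differentiable F x.
  by apply/derivable1_diffP; exact: (FE x).1.
split=> [x _|v]; first exact: differentiable_continuous.
split=> [x _|]; first exact: diff_derivable.
apply: (@real_class_C_eq _ _ _ (fun x => v * f x)); [exact: openT| |].
  move=> x _; rewrite -(FE x).2 deriveE// derive1E'//.
  by rewrite -[in RHS](mulr1 v) -[v * 1]/(v *: (1 : R^o)) linearZ.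
by apply: real_class_CZ => //; exact: openT.
Qed.

Lemma real_class_C_continuous (k : nat) (f : R -> R) :
  real_class_C k setT f -> continuous f.
Proof. by case: k => [|k] [fc _] x; exact: fc. Qed.

End Smoothness.

(** * Primitives of continuous functions and integrals over half-lines *)

Section Primitive.
Variables (R : realType) (k : R -> R).
Hypothesis kc : continuous k.
Local Notation mu := (@lebesgue_measure R).

Lemma continuous_integrable_itv (a b : R) : mu.-integrable `[a, b] (EFin \o k).
Proof.
apply: continuous_compact_integrable; first exact: segment_compact.
exact: continuous_subspaceT.
Qed.

(** The oriented integral of [k] from 0 to [x]. *)
Definition primitive (x : R) : R :=
  if 0 <= x then \int[mu]_(t in `[0, x]) k t else - \int[mu]_(t in `[x, 0]) k t.

Lemma Rintegral_itvB_segment (i : itv_bound R) (a : R) :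
  mu.-integrable [set` Interval (BLeft a) i] (EFin \o k) ->
  forall b, a <= b -> (BRight b <= i)%O ->
  \int[mu]_(t in [set` Interval (BLeft a) i]) k t =
  \int[mu]_(t in `[a, b]) k t + \int[mu]_(t in [set` Interval (BLeft b) i]) k t.
Proof.
move=> ik b ab bi.
rewrite -(@Rintegral_itv_obnd_cbnd _ b).
  by rewrite -(@Rintegral_itvB _ _ (BLeft a))//= addrC subrK.
by apply: integrableS ik => //; apply: subset_itvr; rewrite bnd_simp.
Qed.

(** A base point to the left of both 0 and [x] removes the case distinction on the sign of [x]. *)
Lemma primitiveE (a x : R) : a <= 0 -> a <= x ->
  primitive x = \int[mu]_(t in `[a, x]) k t - \int[mu]_(t in `[a, 0]) k t.
Proof.
move=> a0 ax; rewrite /primitive; case: (leP 0 x) => x0.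
  rewrite (@Rintegral_itvB_segment (BRight x) a _ 0)//; first by rewrite addrC addKr.
  exact: continuous_integrable_itv.
rewrite (@Rintegral_itvB_segment (BRight 0) a _ x) ?bnd_simp ?(ltW x0)//.
  by rewrite opprD addrA subrr add0r.
exact: continuous_integrable_itv.
Qed.

Lemma primitive_segment (a b : R) : a <= b ->
  \int[mu]_(t in `[a, b]) k t = primitive b - primitive a.
Proof.
move=> ab; pose c := Num.min a 0.
have [c0 ca] : c <= 0 /\ c <= a by rewrite /c; split; rewrite ge_min lexx ?orbT.
rewrite (primitiveE c0 ca) (primitiveE c0 (le_trans ca ab)).
rewrite opprB addrA addrNK (@Rintegral_itvB_segment (BRight b) c _ a)//.
  by rewrite addrC addKr.
exact: continuous_integrable_itv.
Qed.

Lemma primitive_derive (x : R) :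
  derivable primitive x 1 /\ primitive^`()%classic x = k x.
Proof.
(* The shift by 1 puts [a] strictly left of [x], so that the same base point serves in a
   neighbourhood of [x]. *)
pose a := Num.min x 0 - 1.
have ax : a < x by rewrite /a ltrBlDr (@le_lt_trans _ _ x) ?ge_min ?lexx// ltrDl.
have a0 : a <= 0 by rewrite /a lerBlDr (@le_trans _ _ 0) ?ge_min ?lexx ?orbT// add0r.
have x1 : x < x + 1 by rewrite ltrDl.
have [dG GE] := @continuous_FTC1_closed R k a x (x + 1) x1
  (continuous_integrable_itv _ _) ax (@kc x).
pose G y := \int[mu]_(t in `[a, y]) k t.
have near_G : \near x, G x - \int[mu]_(t in `[a, 0]) k t = primitive x.
  have : \forall y \near x, a < y by exact: lt_nbhsr.
  by apply: filterS => y /ltW ay; rewrite (primitiveE a0 ay).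
have dGc : is_derive x 1 (G - cst (\int[mu]_(t in `[a, 0]) k t)) (k x).
  rewrite -[k x]subr0; apply: is_deriveB.
  by split=> //; rewrite -derive1E.
have := near_eq_is_derive near_G dGc.
by case=> dp pE; split=> //; rewrite derive1E.
Qed.

Lemma integrable_setU_disj (A B : set R) : measurable A -> measurable B ->
  A `&` B = set0 -> mu.-integrable A (EFin \o k) -> mu.-integrable B (EFin \o k) ->
  mu.-integrable (A `|` B) (EFin \o k).
Proof.
move=> mA mB AB kA kB.
have {}kA := iffLR (@integrable_mkcond _ _ _ mu A (EFin \o k) mA) kA.
have {}kB := iffLR (@integrable_mkcond _ _ _ mu B (EFin \o k) mB) kB.
apply/integrable_mkcond; first exact: measurableU.
apply: eq_integrable (integrableD measurableT kA kB) => // x _.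
rewrite /= !patchE in_setU; case: (boolP (x \in A)) => xA;
  case: (boolP (x \in B)) => xB.
- have : (A `&` B) x by split; exact: set_mem.
  by rewrite AB.
- by rewrite adde0.
- by rewrite add0e.
- by rewrite adde0.
Qed.

Lemma integrable_upray : mu.-integrable `[0, +oo[ (EFin \o k) ->
  forall a, mu.-integrable `[a, +oo[ (EFin \o k).
Proof.
move=> k0 a; have [a0|a0] := leP 0 a.
  by apply: integrableS k0 => //; apply: subset_itvr; rewrite bnd_simp.
have -> : `[a, +oo[%classic = `[a, 0[%classic `|` `[0, +oo[%classic :> set R.
  by rewrite -itv_bndbnd_setU// bnd_simp ltW.
apply: integrable_setU_disj => //.
  apply/seteqP; split=> x //= [/=]; rewrite !in_itv/= andbT => /andP[_ x0].
  by rewrite leNgt x0.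
apply: integrableS (continuous_integrable_itv a 0) => //.
exact: subset_itv_co_cc.
Qed.

Lemma integrable_downray : mu.-integrable `]-oo, 0] (EFin \o k) ->
  forall a, mu.-integrable `]-oo, a] (EFin \o k).
Proof.
move=> k0 a; have [a0|a0] := leP a 0.
  by apply: integrableS k0 => //; apply: subset_itvl; rewrite bnd_simp.
have -> : `]-oo, a]%classic = `]-oo, 0]%classic `|` `]0, a]%classic :> set R.
  by rewrite -itv_bndbnd_setU// bnd_simp ltW.
apply: integrable_setU_disj => //.
  apply/seteqP; split=> x //= [/=]; rewrite !in_itv/= => x0 /andP[].
  by rewrite ltNge x0.
apply: integrableS (continuous_integrable_itv 0 a) => //.
exact: subset_itv_oc_cc.
Qed.

Lemma primitive_upray : mu.-integrable `[0, +oo[ (EFin \o k) -> forall a,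
  \int[mu]_(t in `[a, +oo[) k t = \int[mu]_(t in `[0, +oo[) k t - primitive a.
Proof.
move=> /integrable_upray k0 a; pose c := Num.min a 0.
have [c0 ca] : c <= 0 /\ c <= a by rewrite /c; split; rewrite ge_min lexx ?orbT.
have := @Rintegral_itvB_segment +oo%O c (k0 c) a ca isT.
have := @Rintegral_itvB_segment +oo%O c (k0 c) 0 c0 isT.
rewrite !primitive_segment// /primitive lexx set_itv1 Rintegral_set1.
set p := primitive a; lra.
Qed.

Lemma primitive_downray : mu.-integrable `]-oo, 0] (EFin \o k) -> forall a,
  \int[mu]_(t in `]-oo, a]) k t = \int[mu]_(t in `]-oo, 0]) k t + primitive a.
Proof.
move=> /integrable_downray k0 a; pose c := Num.max a 0.
have [c0 ca] : 0 <= c /\ a <= c by rewrite /c; split; rewrite le_max lexx ?orbT.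
have step b : b <= c ->
    \int[mu]_(t in `]-oo, c]) k t - \int[mu]_(t in `]-oo, b]) k t =
    primitive c - primitive b.
  move=> bc; rewrite (@Rintegral_itvB _ _ -oo%O (BRight c)) ?bnd_simp//.
  rewrite Rintegral_itv_obnd_cbnd ?primitive_segment//.
  apply: integrableS (continuous_integrable_itv b c) => //.
  exact: subset_itv_oc_cc.
have := step _ c0; have := step _ ca.
have -> : primitive 0 = 0 by rewrite /primitive lexx set_itv1 Rintegral_set1.
lra.
Qed.

End Primitive.

(** * Integrals over intervals whose endpoints are linear in the form *)

Section Pieces.
Variables (R : realType) (V : vectType R).
Local Notation mu := (@lebesgue_measure R).

(** [up] and [down] guard the unbounded cases; they will be the integrability of [kappa] on the two
    half-lines. The vectors [v] and [w] are common to all forms of [U]. *)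
Definition image_shape (up down : Prop) (U : set (normedvect (dual V)))
    (S : dual V -> set R) :=
  [\/ exists v w, forall xi : dual V, U xi ->
        xi v <= xi w /\ S xi = `[(xi v : R), (xi w : R)]%classic,
      up /\ exists v, forall xi : dual V, U xi -> S xi = `[(xi v : R), +oo[%classic,
      down /\ exists v, forall xi : dual V, U xi -> S xi = `]-oo, (xi v : R)]%classic
    | forall xi : dual V, U xi -> S xi = set0].

Lemma real_class_C_eval (q : nat) (U : set (normedvect (dual V))) (v : V)
    (f : R -> R) :
  real_class_C q setT f ->
  real_class_C q U (fun xi : normedvect (dual V) => f ((xi : dual V) v)).
Proof.
pose L : {linear normedvect (dual V) -> R^o} := eval_fun v.
apply: (@real_class_C_linear R _ _ q U L).
exact: dual_eval_continuous.
Qed.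

(** In every case the integral is a constant plus or minus values of [primitive k] at linear forms
    in [xi]. *)
Lemma image_shape_class_C (q : nat) (k : R -> R) (up down : Prop)
    (U : set (normedvect (dual V))) (S : dual V -> set R) :
  open U -> real_class_C q setT k ->
  (up -> mu.-integrable `[0, +oo[ (EFin \o k)) ->
  (down -> mu.-integrable `]-oo, 0] (EFin \o k)) ->
  image_shape up down U S ->
  (forall xi : dual V, U xi -> measurable (S xi) /\ mu.-integrable (S xi) (EFin \o k)) /\
  real_class_C q.+1 U (fun xi => \int[mu]_(t in S xi) k t).
Proof.
move=> Uopen kC kup kdown shapeS.
have kc := real_class_C_continuous kC.
have primC v : real_class_C q.+1 U
    (fun xi : normedvect (dual V) => primitive k ((xi : dual V) v)).
  apply: real_class_C_eval; apply: real_class_C_primitive kC.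
  exact: primitive_derive.
case: shapeS => [[v [w vw]]|[u [v Sv]]|[u [v Sv]]|S0]; split.
- by move=> xi /vw[_ ->]; split=> //; exact: continuous_integrable_itv.
- apply: (real_class_C_eq Uopen) (real_class_CD Uopen (primC w)
    (real_class_CZ (-1) Uopen (primC v))) => xi /vw[vwxi ->].
  by rewrite mulN1r primitive_segment.
- by move=> xi /Sv ->; split=> //; apply: integrable_upray => //; exact: kup.
- apply: (real_class_C_eq Uopen) (real_class_CD Uopen
    (real_class_C_cst q.+1 (\int[mu]_(t in `[0, +oo[) k t) Uopen)
    (real_class_CZ (-1) Uopen (primC v))) => xi /Sv ->.
  by rewrite mulN1r [RHS]primitive_upray//; exact: kup.
- by move=> xi /Sv ->; split=> //; apply: integrable_downray => //; exact: kdown.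
- apply: (real_class_C_eq Uopen) (real_class_CD Uopen
    (real_class_C_cst q.+1 (\int[mu]_(t in `]-oo, 0]) k t) Uopen)
    (primC v)) => xi /Sv ->.
  by rewrite [RHS]primitive_downray//; exact: kdown.
- move=> xi /S0 ->; split=> //; apply: integrableS (continuous_integrable_itv kc 0 0) => //.
- apply: (real_class_C_eq Uopen) (real_class_C_cst q.+1 0 Uopen) => xi /S0 ->.
  by rewrite Rintegral_set0.
Qed.

Lemma Rintegral_sum_patch (I : Type) (r : seq I) (a : I -> R) (S : I -> set R)
    (k : R -> R) :
  (forall i, measurable (S i) /\ mu.-integrable (S i) (EFin \o k)) ->
  mu.-integrable setT (fun t => (\sum_(i <- r) a i * (k \_ (S i)) t)%:E) /\
  \int[mu]_t (\sum_(i <- r) a i * (k \_ (S i)) t) =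
    \sum_(i <- r) a i * \int[mu]_(t in S i) k t.
Proof.
move=> kS.
have kSi i : mu.-integrable setT (EFin \o (k \_ (S i))).
  have [mS kSi] := kS i.
  have := iffLR (@integrable_mkcond _ _ _ mu (S i) (EFin \o k) mS) kSi.
  by rewrite restrict_EFin.
elim: r => [|i r [IHint IHeq]].
  under eq_fun do rewrite big_nil; under eq_Rintegral do rewrite big_nil.
  rewrite big_nil Rintegral_cst// mul0r; split=> //; exact: integrable0.
have kSZ : mu.-integrable setT (EFin \o (fun t => a i * (k \_ (S i)) t)).
  by have := integrableZl measurableT (a i) (kSi i).
under eq_fun do rewrite big_cons; under eq_Rintegral do rewrite big_cons.
rewrite big_cons; split; first exact: (integrableD measurableT kSZ IHint).
by rewrite RintegralD// IHeq RintegralZl// -Rintegral_mkcond.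
Qed.

End Pieces.

(** * Pushforward and hybrid transform *)

Section Pushforward.
Variables (R : realType) (V : vectType R).

(** The two elements of [bool] index the inequalities that together say [xi x = t], so a slice is
    again a closed polyhedron. *)
Definition slice_form (J : finType) (l : J -> dual V) (xi : dual V)
    (j : J + bool) : dual V :=
  match j with inl j => l j | inr true => xi | inr false => - xi end.

Definition slice_bound (J : finType) (c : J -> R) (t : R) (j : J + bool) : R :=
  match j with inl j => c j | inr true => t | inr false => - t end.

Lemma cpoly_slice (J : finType) (l : J -> dual V) (c : J -> R) (xi : dual V)
    (t : R) :
  cpoly (slice_form l xi) (slice_bound c t) =
  cpoly l c `&` [set x : V | xi x = t].
Proof.
apply/seteqP; split=> [x Px|x [Px xt] [j|[]]]; last first.
- by rewrite /= opp_lfunE lerN2 xt.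
- by rewrite /= xt.
- exact: Px.
split; first by move=> j; exact: (Px (inl j)).
apply/eqP; rewrite eq_le; have := Px (inr true); have := Px (inr false).
by rewrite /= opp_lfunE lerN2 => -> ->.
Qed.

(* [e] is 1, or 0 in case no functional satisfies [is_euler_integral] and
   [euler_integral] takes its default value 0. *)
Lemma pushforward_sum (phi : normedvect V -> int) (I J : finType) (m : I -> int)
    (l : I -> J -> dual V) (c : I -> J -> R) :
  (forall x, phi x = \sum_i m i * \1_(cpoly (l i) (c i)) x) ->
  exists e : int, forall (xi : dual V) (t : R),
    (forall i, m i != 0 -> exists M, forall x : normedvect V,
       cpoly (l i) (c i) x -> xi x = t -> `|x| <= M) ->
    Defs.pushforward xi phi t =
      e * \sum_i m i * \1_[set xi x | x in cpoly (l i) (c i)] t.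
Proof.
move=> phiE; rewrite /Defs.pushforward.
have [euler|->] : is_euler_integral (@euler_integral R V) \/
    @euler_integral R V = (fun=> 0); last by exists 0 => xi t _; rewrite mul0r.
  by rewrite /euler_integral; case: xgetP => [I0 _|]; [left|right].
exists 1 => xi t bnd; rewrite mul1r.
pose S i := [set xi x | x in cpoly (l i) (c i)].
(* A nonzero coefficient makes the slice bounded and [t \in S i] makes it nonempty, as compactness
   and contractibility demand; the other terms vanish. *)
pose A := [set i | (m i != 0) && (t \in S i)]%SET.
pose K i := cpoly (slice_form (l i) xi) (slice_bound (c i) t).
transitivity (euler_integral (fun x =>
  \sum_(a < #|A|) m (enum_val a) * \1_(K (enum_val a)) x)).
  congr euler_integral; apply/funext => x.
  rewrite -(big_enum_val (fun i => m i * \1_(K i) x)) phiE mulr_sumr.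
  rewrite [RHS]big_mkcond; apply: eq_bigr => i _ /=.
  rewrite /K cpoly_slice !indicE in_setI andbC.
  case: (boolP (x \in _)) => xP /=; last by rewrite andbF !mulr0 if_same.
  case: (boolP (x \in _)) => xt /=; last by rewrite mul0r mulr0 if_same.
  rewrite mul1r mulr1.
  have tS : t \in S i.
    by apply/mem_set; exists x; [exact: set_mem|exact: (set_mem xt)].
  by rewrite inE tS andbT; case: eqP => [->|].
rewrite euler; last first.
  move=> a; have := enum_valP a; rewrite inE => /andP[m0 /set_mem[x Px xt]].
  have Kcompact : compact (K (enum_val a)).
    apply: bounded_closed_compact_vect; first exact: cpoly_closed.
    have [M Mb] := bnd _ m0; exists M => y; rewrite /K cpoly_slice => -[Py yt].
    exact: Mb.
  split=> //; last exact: cpoly_subanalytic.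
  apply: (@contractible_convex _ _ _ x); last by move=> y z s; exact: cpoly_convex.
  by rewrite /K cpoly_slice.
rewrite -(big_enum_val m) big_mkcond; apply: eq_bigr => i _ /=.
rewrite indicE inE -/(S i); case: eqP => [->|_] /=; first by rewrite mul0r.
by case: (t \in S i); rewrite ?mulr1 ?mulr0.
Qed.

End Pushforward.

(** * Coercivity of forms in the interior of a polar cone, and properness *)

Section Coercivity.
Variables (R : realType) (V : vectType R).

Lemma norm_le_coords (x : normedvect V) (y : R) :
  0 <= y -> (forall i, `|coords x 0 i| <= y) -> `|x| <= y.
Proof.
move=> y0 xy; rewrite normedvect_normE [leLHS]mx_normrE; apply: bigmax_le => //.
by move=> [i j] _; rewrite ord1; exact: xy.
Qed.

(* Perturb xi by small multiples of the coordinate forms. *)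
Lemma interior_polar_coercive (C : set (normedvect V)) (xi : dual V) :
  (polar C)° xi ->
  exists2 e : R, 0 < e & forall x : normedvect V, C x -> e * `|x| <= xi x.
Proof.
move=> /nbhs_ballP[r /= r0 rC].
pose B := \sum_i `|coord_form i : normedvect (dual V)|.
have B0 : 0 <= B by exact: sumr_ge0.
have B1 : 0 < B + 1 by rewrite ltr_wpDl.
(* [B] bounds the norm of every coordinate form, so perturbations by [e] times such a form have norm
   at most [r / 2]. *)
pose e := r / (2 * (B + 1)).
have e0 : 0 < e by rewrite divr_gt0// mulr_gt0.
have near (s : R) i : `|s| = 1 -> polar C (xi + (s * e) *: coord_form i).
  move=> s1; apply: rC; rewrite -ball_normE /ball_/=.
  rewrite opprD addrA subrr add0r normrN.
  rewrite -[X in `|X|]/((s * e) *: (coord_form i : normedvect (dual V))) normrZ.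
  rewrite normrM s1 mul1r (gtr0_norm e0).
  have iB : `|coord_form i : normedvect (dual V)| <= B.
    by rewrite /B (bigD1 i)//= lerDl sumr_ge0.
  apply: (@le_lt_trans _ _ (e * (B + 1))).
    by rewrite ler_wpM2l ?(ltW e0)// (le_trans iB)// lerDl.
  rewrite /e invfM mulrA mulfVK ?gt_eqF//.
  by rewrite ltr_pdivrMr// mulr_natr mulr2n ltrDl.
exists e => // x Cx; rewrite -ler_pdivlMl//.
apply: norm_le_coords => [|i].
  apply: mulr_ge0; first by rewrite invr_ge0 ltW.
  have /nbhs_singleton xiC : nbhs (xi : normedvect (dual V)) (polar C).
    by apply/nbhs_ballP; exists r.
  exact: xiC.
rewrite ler_pdivlMl//.
(* Nonnegativity of both perturbed forms at [x] bounds [e] times the absolute value of the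
   coordinate by [xi x]. *)
have := near 1 i (normr1 _) x Cx; have := near (-1) i (normrN1 _) x Cx.
rewrite !add_lfunE !scale_lfunE coord_formE /GRing.scale/=.
by move=> h1 h2; case: (ler0P (coords x 0 i)) => _; lra.
Qed.

Lemma coercive_sublevel_bounded (K C : set (normedvect V)) (eta : dual V)
    (e t : R) :
  compact K -> 0 < e -> (forall x : normedvect V, C x -> e * `|x| <= eta x) ->
  exists M, forall x : normedvect V,
    [set k + c | k in K & c in C] x -> eta x <= t -> `|x| <= M.
Proof.
move=> /compact_bounded_vect[M KM] e0 eC.
have [N N0 etaN] := @linear_le_norm R V R^o eta.
(* [M] bounds the part in [K]; for the part in [C], [eta c <= t - eta k <= t + N * M] and coercivity
   applies. *)
exists (M + e^-1 * (t + N * M)) => _ [k Kk [c Cc <-]] et.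
rewrite (le_trans (ler_normD _ _))// lerD ?KM//.
rewrite ler_pdivlMl// (le_trans (eC c Cc))//.
have : `|eta k| <= N * M by apply: le_trans (etaN k) _; rewrite ler_wpM2l// KM.
rewrite ler_norml => /andP[Nk _].
by move: et; rewrite linearD /=; lra.
Qed.

Lemma proper_on_bounded (S : set (normedvect V)) (xi : dual V) :
  closed S ->
  (forall B : set R, compact B ->
    exists M, forall x : normedvect V, S x -> B (xi x) -> `|x| <= M) ->
  proper_on S xi.
Proof.
move=> Sclosed Sbnd B Bcompact; apply: bounded_closed_compact_vect.
  apply: closedI => //.
  rewrite (_ : [set x : V | B (xi x)] = (xi : normedvect V -> R) @^-1` B)//.
  apply: preimage_closed; first by move=> x _; exact: dual_continuous.
  by apply: compact_closed => //; exact: norm_hausdorff.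
by have [M Mb] := Sbnd B Bcompact; exists M => x [Sx Bx]; exact: Mb.
Qed.

End Coercivity.

(** * Regularity of the hybrid transform on a chamber *)

Section Hybrid.
Variables (R : realType) (V : vectType R).
Local Notation mu := (@lebesgue_measure R).

(** An empty polyhedron has empty image, a bounded one a segment, an unbounded one a ray; the
    downward ray is the upward one for the opposite forms. *)
Lemma cpoly_image_shape (J : finType) (l : J -> dual V) (c : J -> R)
    (up down : Prop) (U : set (normedvect (dual V))) :
  same_vertex_order l c U ->
  [\/ exists M, forall x : normedvect V, cpoly l c x -> `|x| <= M,
      up /\ (forall xi, U xi -> sublevel_bounded (cpoly l c) xi)
    | down /\ (forall xi, U xi -> sublevel_bounded (cpoly l c) (- (xi : dual V)))] ->
  image_shape up down U (fun xi => [set (xi x : R) | x in cpoly l c]).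
Proof.
move=> Uord bnd.
have imageE (xi : dual V) (A : set R) :
    (forall t, (exists x, cpoly l c x /\ xi x = t) <-> A t) ->
    [set (xi x : R) | x in cpoly l c] = A.
  move=> xiA; apply/seteqP; split=> [t [x Px xt]|t /xiA[x [Px xt]]];
    last by exists x.
  by apply/xiA; exists x.
have [P0|/nonemptyPn P0] := pselect (cpoly l c !=set0); last first.
  by apply: Or44 => xi _; rewrite P0 image_set0.
have [Pbnd|nPbnd] := pselect
    (exists M, forall x : normedvect V, cpoly l c x -> `|x| <= M).
  have [v [w vw]] := chamber_segment P0 Uord Pbnd.
  apply: Or41; exists v, w => xi Uxi; split.
    have [x Px] := P0.
    have /andP[] := iffLR (vw xi (xi x) Uxi) (ex_intro _ x (conj Px erefl)).
    exact: le_trans.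
  by apply: imageE => t; rewrite /= in_itv; exact: vw.
case: bnd => // -[ud Ubnd].
  have [v vP] := chamber_ray P0 Uord Ubnd nPbnd.
  apply: Or42; split=> //; exists v => xi Uxi.
  by apply: imageE => t; rewrite /= in_itv/= andbT; exact: vP.
have [_ [xi Uxi <-]|v vP] := chamber_ray P0 (same_vertex_orderN Uord) _ nPbnd.
  exact: Ubnd.
apply: Or43; split=> //; exists v => xi Uxi; apply: imageE => t.
rewrite /= in_itv/= -lerN2 -opp_lfunE -vP; last by exists xi.
by split=> -[x [Px xt]]; exists x; split=> //; move: xt; rewrite opp_lfunE;
  [move=> ->|move/oppr_inj].
Qed.

Lemma Re_mulz (z : R[i]) (n : int) : complex.Re (z *~ n) = complex.Re z * n%:~R.
Proof.
rewrite mulrzr.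
exact: (raddfMz (@complex.Re R : {linear Rcomplex R -> R | *%R}) n z).
Qed.

Lemma Im_mulz (z : R[i]) (n : int) : complex.Im (z *~ n) = complex.Im z * n%:~R.
Proof.
rewrite mulrzr.
exact: (raddfMz (@complex.Im R : {linear Rcomplex R -> R | *%R}) n z).
Qed.

(** The pushforward is a combination of indicators of the images of the polyhedra, so the transform
    is the same combination of integrals of [kappa] over these images. *)
Lemma hybrid_class_C (phi : normedvect V -> int) (I J : finType) (m : I -> int)
    (l : I -> J -> dual V) (c : I -> J -> R) (p : nat) (kappa : R -> R[i])
    (U : set (normedvect (dual V))) :
  (forall x, phi x = \sum_i m i * \1_(cpoly (l i) (c i)) x) ->
  (forall i, m i != 0 -> cpoly (l i) (c i) `<=` supp phi) ->
  class_C p setT kappa -> open U ->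
  (forall xi, U xi -> proper_on (supp phi) xi) ->
  (forall i, m i != 0 -> image_shape (cintegrable `[0, +oo[ kappa)
     (cintegrable `]-oo, 0] kappa) U
     (fun xi => [set (xi x : R) | x in cpoly (l i) (c i)])) ->
  U `<=` hybrid_domain kappa phi /\ class_C p.+1 U (hybrid kappa phi).
Proof.
move=> phiE msupp [ReC ImC] Uopen Uproper shapes.
have [e pushE] := pushforward_sum phiE.
(* Polyhedra with coefficient 0 are uncontrolled, so their image is replaced by the empty set. *)
pose S i (xi : dual V) : set R :=
  if m i == 0 then set0 else [set (xi x : R) | x in cpoly (l i) (c i)].
pose a i : R := (e * m i)%:~R.
have Sshape i : image_shape (cintegrable `[0, +oo[ kappa)
    (cintegrable `]-oo, 0] kappa) U (S i).
  rewrite /S; case: eqP => [_|/eqP]; last exact: shapes.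
  by apply: Or44.
have pushU (xi : dual V) t : U xi ->
    (Defs.pushforward xi phi t)%:~R = \sum_i a i * \1_(S i xi) t :> R.
  move=> Uxi; rewrite pushE => [|i mi0].
    rewrite mulr_sumr rmorph_sum; apply: eq_bigr => i _; rewrite /a /S.
    case: eqP => [->|_]; first by rewrite mul0r !mulr0 mul0r.
    by rewrite mulrA rmorphM/= !indicE; congr (_ * _); case: (_ \in _).
  (* Properness at the single value [t] bounds the slice of the support, hence that of each
     polyhedron inside it. *)
  have [M Mb] := compact_bounded_vect (Uproper xi Uxi [set t] (@compact_set1 _ t)).
  by exists M => x Px xt; apply: Mb; split=> //; exact: msupp Px.
(* Treats real and imaginary parts at once. *)
have part (k : R -> R) (part : R[i] -> R) : k = part \o kappa ->
    (forall z n, part (z *~ n) = part z * n%:~R) -> real_class_C p setT k ->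
    (cintegrable `[0, +oo[ kappa -> mu.-integrable `[0, +oo[ (EFin \o k)) ->
    (cintegrable `]-oo, 0] kappa -> mu.-integrable `]-oo, 0] (EFin \o k)) ->
    (forall xi, U xi -> mu.-integrable setT
       (fun t => (part (kappa t *~ Defs.pushforward xi phi t))%:E)) /\
    real_class_C p.+1 U
       (fun xi => \int[mu]_t part (kappa t *~ Defs.pushforward xi phi t)).
  move=> kE partM kC kup kdown.
  have partE (xi : dual V) : U xi ->
      (fun t => part (kappa t *~ Defs.pushforward xi phi t)) =
      (fun t => \sum_i a i * (k \_ (S i xi)) t).
    move=> Uxi; apply/funext => t; rewrite partM pushU// mulr_sumr.
    apply: eq_bigr => i _; rewrite mulrCA patchE indicE kE /=.
    by case: (_ \in _); rewrite ?mulr1 ?mulr0.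
  have pieces i := image_shape_class_C Uopen kC kup kdown (Sshape i).
  have sums (xi : dual V) (Uxi : U xi) := Rintegral_sum_patch (index_enum I) a
    (fun i => (pieces i).1 xi Uxi).
  split=> [xi Uxi|].
    rewrite [X in mu.-integrable _ X](_ : _ =
      EFin \o (fun t => \sum_i a i * (k \_ (S i xi)) t));
      first exact: (sums xi Uxi).1.
    by rewrite -(partE xi Uxi).
  apply: (real_class_C_eq Uopen) (real_class_C_sum (index_enum I) Uopen
    (fun i => real_class_CZ (a i) Uopen (pieces i).2)) => xi Uxi.
  by rewrite -(sums xi Uxi).2 (partE xi Uxi).
have [Reint ReC'] := part _ _ erefl Re_mulz ReC (fun h => h.1) (fun h => h.1).
have [Imint ImC'] := part _ _ erefl Im_mulz ImC (fun h => h.2) (fun h => h.2).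
split; last by split.
by move=> xi Uxi; split; [exact: Uproper|split; [exact: Reint|exact: Imint]].
Qed.

End Hybrid.

Theorem proposition4p2 (R : realType) (V : vectType R)
    (dimV : (0 < \dim {:V})%N)
    (phi : normedvect V -> int) (phiPL : PL_constructible phi)
    (p : nat) (kappa : R -> R[i]) (kappaC : class_C p setT kappa) :
  exists (m : nat) (Gamma : 'I_m -> set (normedvect (dual V))),
    [/\ forall i, [/\ open (Gamma i), convex_polyhedron (Gamma i)
                    & cone (Gamma i)],
        \bigcup_i closure (Gamma i) = setT,
        compact (supp phi) ->
          forall i, Gamma i `<=` hybrid_domain kappa phi /\
            class_C p.+1 (Gamma i) (hybrid kappa phi)
      & forall K C : set (normedvect V),
          convex_set K -> compact K ->
          C !=set0 -> closed C -> convex_set C -> cone C -> C <> [set 0] ->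
          supp phi `<=` [set k + c | k in K & c in C] ->
          (cintegrable `[0, +oo[ kappa ->
             forall i,
               Gamma i `&` (polar C)° `<=` hybrid_domain kappa phi /\
               class_C p.+1 (Gamma i `&` (polar C)°) (hybrid kappa phi)) /\
          (cintegrable `]-oo, 0] kappa ->
             forall i,
               Gamma i `&` (polar (antipode C))° `<=`
                 hybrid_domain kappa phi /\
               class_C p.+1 (Gamma i `&` (polar (antipode C))°)
                 (hybrid kappa phi))].
Proof.
have [I [J [m [l [c [phiE msupp]]]]]] := PL_constructible_decomposition phiPL.
(* Differences of two vertices of the same polyhedron [k.1.1]; their signs under [xi] fix the order
   of the vertex values. *)
pose dir (k : I * {set J} * {set J}) : V :=
  vertex (l k.1.1) (c k.1.1) k.2 - vertex (l k.1.1) (c k.1.1) k.1.2.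
(* A zero difference would make every chamber empty. *)
pose D := {k : I * {set J} * {set J} | dir k != 0}.
pose d (k : D) := dir (val k).
have d0 k : d k != 0 by exact: (valP k).
pose Gamma (i : 'I_#|{ffun D -> bool}|) := chamber d (enum_val i).
have order_in i (U : set (normedvect (dual V))) : U `<=` Gamma i ->
    forall a, same_vertex_order (l a) (c a) U.
  move=> UG a xi xi' S S' /UG xiG /UG xi'G.
  rewrite -subr_ge0 -[_ <= xi' _]subr_ge0 -!linearB/=.
  change (0 <= xi (dir (a, S, S')) -> 0 <= xi' (dir (a, S, S'))).
  have [->|dk] := eqVneq (dir (a, S, S')) 0; first by rewrite !linear0.
  exact: (@chamber_order _ _ _ d _ xi xi' (exist _ (a, S, S') dk)).
exists #|{ffun D -> bool}|, Gamma; split.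
- move=> i; split; first exact: chamber_open.
    exact: chamber_polyhedron.
  exact: chamber_cone.
- apply/seteqP; split=> // xi _; have [s xis] := chamber_cover d0 xi.
  by exists (enum_rank s) => //; rewrite /Gamma enum_rankK.
- move=> cphi i; apply: (hybrid_class_C phiE msupp kappaC); first exact: chamber_open.
    move=> xi _; have [M Mb] := compact_bounded_vect cphi.
    apply: proper_on_bounded; first exact: closed_closure.
    by move=> B _; exists M => x /Mb.
  move=> a ma; apply: cpoly_image_shape; first exact: (@order_in i).
  have [M Mb] := compact_bounded_vect cphi.
  (* Compact support bounds each polyhedron with nonzero coefficient, so no rays occur. *)
  by apply: Or31; exists M => x Px; apply: Mb; exact: msupp Px.
move=> K C _ Kcompact _ _ _ _ _ phiKC.
have sublevel (eta : dual V) (e : R) : 0 < e ->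
    (forall x : normedvect V, C x -> e * `|x| <= eta x) ->
    sublevel_bounded (supp phi) eta.
  move=> e0 eC t; have [M Mb] := coercive_sublevel_bounded t Kcompact e0 eC.
  by exists M => x /phiKC; exact: Mb.
have interval_bound (B : set R) : compact B -> exists M, forall t, B t -> `|t| <= M.
  move=> /compact_bounded[M [_ BM]]; exists (M + 1) => t Bt.
  by apply: (BM (M + 1)) => //; rewrite ltrDl.
split=> kint i.
  have Ubnd (xi : dual V) : (Gamma i `&` (polar C)°) xi ->
      sublevel_bounded (supp phi) xi.
    by move=> [_ /interior_polar_coercive[e e0 eC]]; exact: sublevel eC.
  apply: (hybrid_class_C phiE msupp kappaC).
  - by apply: openI; [exact: chamber_open|exact: open_interior].
  - move=> xi /Ubnd Uxi; apply: proper_on_bounded; first exact: closed_closure.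
    (* A compact set of values lies below [N], so its preimage in the support lies in a bounded
       sublevel set. *)
    move=> B /interval_bound[N BN]; have [M Mb] := Uxi N; exists M => x Sx Bx.
    by apply: Mb => //; apply: le_trans (ler_norm _) (BN _ Bx).
  move=> a ma; apply: cpoly_image_shape; first by apply: (@order_in i) => xi [].
  apply: Or32; split=> // xi /Ubnd Uxi t; have [M Mb] := Uxi t.
  by exists M => x Px; apply: Mb; exact: msupp Px.
(* Coercivity of [xi] on the antipode is coercivity of [- xi] on [C], so rays now point
   downwards. *)
have Ubnd (xi : dual V) : (Gamma i `&` (polar (antipode C))°) xi ->
    sublevel_bounded (supp phi) (- xi).
  move=> [_ /interior_polar_coercive[e e0 eC]]; apply: (sublevel _ e) => // x Cx.
  by rewrite -normrN opp_lfunE -linearN; apply: eC; exists x.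
apply: (hybrid_class_C phiE msupp kappaC).
- by apply: openI; [exact: chamber_open|exact: open_interior].
- move=> xi /Ubnd Uxi; apply: proper_on_bounded; first exact: closed_closure.
  move=> B /interval_bound[N BN]; have [M Mb] := Uxi N; exists M => x Sx Bx.
  apply: Mb => //; rewrite opp_lfunE.
  by apply: le_trans (ler_norm _) _; rewrite normrN; exact: BN.
move=> a ma; apply: cpoly_image_shape; first by apply: (@order_in i) => xi [].
apply: Or33; split=> // xi /Ubnd Uxi t; have [M Mb] := Uxi t.
by exists M => x Px; apply: Mb; exact: msupp Px.
Qed.
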